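(* Let $n\in\mathbb{N}$, $0<c_0\le2^{-24}$, let $d\le c_0^2n$ be a positive integer, let $\alpha\in(0,1)$, let $0\le k\le2^{-10}\alpha d$ be an integer and let $N\le\exp(2^{-10}\alpha d)$. Let $X\in\mathbb{R}^d$ satisfy $\|X\|_2\ge c_02^{-10}n^{1/2}N$, and let $H$ be a random $(n-d)\times2d$ matrix with i.i.d. entries in $\{-1,0,1\}$, each equal to $\pm1$ with probability $1/8$ each and $0$ with probability $3/4$. Set $H_1:=H_{[n-d]\times[d]}$, $H_2:=H_{[n-d]\times[d+1,2d]}$, $r_n:=\frac{c_0}{16\sqrt n}$ and $R:=2^{39}c_0^{-3}$. If $D_\alpha(r_nX)>16$, then \[\mathbb{P}_H\Big(\sigma_{2d-k+1}(H)\le c_02^{-4}\sqrt n\ \text{ and }\ \|H_1X\|_2\le n,\ \|H_2X\|_2\le n\Big)\le e^{-c_0nk/4}\Big(\frac RN\Big)^{2n-2d}.\]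
   Context: For a matrix $H$, $\sigma_1(H)\ge\sigma_2(H)\ge\cdots$ denote its singular values, with the convention $\sigma_j(H)=0$ for $j>\mathrm{rk}(H)$. $H_{S\times T}$ denotes the submatrix with rows in $S$ and columns in $T$; $[a,b]=\{a,\dots,b\}$ and $[m]=\{1,\dots,m\}$. For $x\in\mathbb{R}^d$, $\|x\|_{\mathbb{T}}$ is the Euclidean distance from $x$ to $\mathbb{Z}^d$, and for $v\in\mathbb{R}^d$ and $\alpha\in(0,1)$, $D_\alpha(v):=\inf\{\phi>0:\|\phi v\|_{\mathbb{T}}\le\min\{\phi\|v\|_2/2,\sqrt{\alpha d}\}\}$. *)

(* Defs.v *)
From HB Require Import structures.
From mathcomp Require Import all_boot all_order all_algebra.
From mathcomp Require Import boolp classical_sets reals sequences exp.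
From Stdlib Require Import ClassicalEpsilon.

Set Implicit Arguments.
Unset Strict Implicit.
Unset Printing Implicit Defensive.

Import Order.TTheory GRing.Theory Num.Theory.
Local Open Scope ring_scope.

Section Defs.
Variable R : realType.

Definition norm2 {m : nat} (v : 'cV[R]_m) : R :=
  Num.sqrt (\sum_(i < m) v i 0 ^+ 2).

Definition torus_norm {m : nat} (x : 'cV[R]_m) : R :=
  inf [set r : R | exists z : 'cV[int]_m,
         r = norm2 (x - map_mx (fun t : int => t%:~R) z)].

Definition D_alpha {m : nat} (alpha : R) (v : 'cV[R]_m) : R :=
  inf [set phi : R | 0 < phi /\
         torus_norm (phi *: v) <= Num.min (phi * norm2 v / 2) (Num.sqrt (alpha * m%:R))].

Definition sorted_eigs {m : nat} (A : 'M[R]_m) (s : seq R) : Prop :=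
  sorted (fun x y : R => y <= x) s /\ size s = m /\
  char_poly A = \prod_(x <- s) ('X - x%:P).

Definition eigs_of {m : nat} (A : 'M[R]_m) : seq R :=
  epsilon (inhabits [::]) (sorted_eigs A).

(* sigma_j(H), j >= 1: sqrt of the j-th largest eigenvalue of H^T H;
   equals 0 for j > number of columns (and hence for j > rank). *)
Definition sing_val {p q : nat} (H : 'M[R]_(p, q)) (j : nat) : R :=
  Num.sqrt (nth 0 (eigs_of (H^T *m H)) j.-1).

Definition entry_val (t : 'I_3) : R := (t : nat)%:R - 1.
Definition entry_weight (t : 'I_3) : R :=
  if (t : nat) == 1%N then 3 / 4 else 1 / 8.

Definition probH {p q : nat} (E : 'M[R]_(p, q) -> bool) : R :=
  \sum_(M : 'M['I_3]_(p, q) | E (map_mx entry_val M))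
     \prod_(i < p) \prod_(j < q) entry_weight (M i j).

End Defs.

(* Main.v *)
Require Import Defs.
From mathcomp Require Import all_boot all_order all_algebra.
From mathcomp Require Import boolp classical_sets reals sequences exp.
From mathcomp Require Import spectral complex ring lra.
From mathcomp Require Import topology normedtype derive realfun trigo.
From Stdlib Require Import ClassicalEpsilon.
Import Order.TTheory GRing.Theory Num.Theory.
Local Open Scope ring_scope.

(** Proof idea. It suffices to bound
[E f(tau)] for one row [tau = (tau1, tau2)] and a nonnegative [f] whose product
over the rows dominates the indicator of the event. Take
[f = K(<v, tau1>) K(<v, tau2>) G(tau)], with [v = r_n X], where [K] is a sum of
shifted Fejer kernels of bandwidth 16 and [G] is a product of characteristic
functions dominating [exp (- c |B^T tau|^2)]. Expanding [f] in characters leads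
to the values [F(t1, t2)] of the Fourier transform of [G] at [(t1 v, t2 v)],
[|t1|, |t2| <= 16]. They satisfy two bounds: [F <= F(0) <= exp (- c k)], a small
ball estimate for quadratic forms, and [F <= exp (C k - c dist^2)], where [dist]
is the distance of [(t1 v, t2 v)] to the integers. Since [D_alpha (r_n X) > 16],
that distance is at least [min (|t| |v| / 2, sqrt (alpha d))]; averaging a
geometric mean of the two bounds over [t1, t2] gains [|v|^-2 exp (- c k)].

Here [B] comes from a [k]-dimensional space on which [H] is small, rounded to a
grid so that a union bound applies. The rounding spoils the operator norm, which
is repaired by passing to a resolvent. *)

(** The obstacle is that both gains, [N^-2] and [exp (- c k)], are wanted from the same row, whose
    products with [v] and with [B] are dependent. Working with characters avoids conditioning:
    multiplying by a character only moves the point where the transform of [G] is evaluated. An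
    entry of [H] vanishes with probability 3/4, so its characteristic function is positive; the same
    function can therefore build the weight [G] and appear in its transform. Constants. The
    hypothesis on [D_alpha] speaks of [|t| <= 16] only, hence the bandwidth. The scale [r_n] makes a
    typical [<v, tau>] at most of order [r_n sqrt n = c0 / 16] on the event, so that bounding all
    kernels from below costs just [2^(4n)]. The grid has about [(48 / c0)^(4dk)] points; since
    [d <= c0^2 n], this is [exp (O(c0 n k))], as is the cost of the weight. The rows gain about
    [exp (- n k / 2^16)], and [c0 <= 2^-24] lets this gain win and leave [exp (- c0 n k / 4)]. *)

Set Implicit Arguments.
Unset Strict Implicit.
Unset Printing Implicit Defensive.
Import numFieldNormedType.Exports.

(** ** Trigonometric estimates *)

Section Trigonometry.
Variable R : realType.
Implicit Types x y w a : R.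

Lemma sin_MVT x : 0 < x -> exists2 c, 0 < c < x & sin x = cos c * x.
Proof.
move=> x0.
have ds y : y \in `]0, x[ -> is_derive y 1 (@sin R) (cos y) by move=> _; exact: is_derive_sin.
have cs : {within `[0, x], continuous (@sin R)}%classic.
  exact/continuous_subspaceT/continuous_sin.
have [c] := MVT x0 ds cs.
rewrite in_itv /= sin0 !subr0 => cx ->.
by exists c.
Qed.

Lemma normr_sin_le x : `|sin x| <= `|x|.
Proof.
wlog x0 : x / 0 < x => [H|].
  have [|x0|->] := ltgtP x 0; last by rewrite sin0.
  - by rewrite -oppr_gt0 => /H; rewrite sinN !normrN.
  - exact: H.
have [c _ ->] := sin_MVT x0.
by rewrite normrM ler_piMl // cos_max.
Qed.

Lemma cos_half_angle x : 1 - cos x = 2 * sin (x / 2) ^+ 2.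
Proof.
rewrite [in LHS](_ : x = (x / 2) *+ 2); last by rewrite -mulr_natr; field.
rewrite cos_mulr2n cos2sin2; ring.
Qed.

Lemma one_sub_cos_le x : 1 - cos x <= x ^+ 2 / 2.
Proof.
rewrite cos_half_angle.
have : `|sin (x / 2)| ^+ 2 <= `|x / 2| ^+ 2 by rewrite lerXn2r ?nnegrE ?normr_sin_le.
rewrite !real_normK ?num_real //; nra.
Qed.

(** Write [sin x = 2 cos (x/2) sin (x/2)] and [sin (x/2) = cos c * x/2] with [c < x/2]; both cosines
    are at least [cos (pi/4)], whose square is 1/2. *)
Lemma sin_lower_bound x : 0 <= x <= pi / 2 -> x / 2 <= sin x.
Proof.
case/andP; rewrite le_eqVlt => /orP[/eqP<-|x0 xpi]; first by rewrite sin0 mul0r.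
have p0 := pi_gt0 R.
have c4 : 0 < cos (pi / 4 : R) /\ cos (pi / 4 : R) ^+ 2 = 1 / 2.
  split; first by apply: cos_gt0_pihalf; lra.
  have : cos ((pi / 4 : R) *+ 2) = 0.
    by rewrite (_ : _ *+ 2 = pi / 2 :> R) ?cos_pihalf // -mulr_natr; field.
  rewrite cos_mulr2n -mulr_natr; lra.
have h c : 0 <= c <= pi / 4 -> cos (pi / 4 : R) <= cos c.
  move=> /andP[c0 cp]; rewrite leNgt; apply/negP => hc.
  move: hc; rewrite ltr_cos ?in_itv /=; lra.
have x20 : 0 < x / 2 by lra.
have [c /andP[c0 cx] sE] := sin_MVT x20.
have hc : cos (pi / 4 : R) <= cos c by apply: h; lra.
have hx : cos (pi / 4 : R) <= cos (x / 2) by apply: h; lra.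
have -> : sin x = 2 * (cos (x / 2) * sin (x / 2)).
  by rewrite mulr_natl -sin_mulr2n; congr sin; rewrite -[_ *+ 2]mulr_natr; field.
rewrite sE; case: c4 => c40 c42.
have : 1 / 2 <= cos (x / 2) * cos c by rewrite -c42 expr2 ler_pM // ltW.
move=> /(ler_wpM2r (ltW x0)). lra.
Qed.

Lemma one_sub_cos_ge w : `|w| <= 1 / 2 -> 2 * w ^+ 2 <= 1 - cos (2 * pi * w).
Proof.
move=> wle.
have -> : cos (2 * pi * w) = cos (2 * pi * `|w|).
  by case: (leP 0 w) => [/ger0_norm|/ltr0_norm] ->; rewrite ?mulrN ?cosN.
rewrite cos_half_angle -[w ^+ 2]real_normK ?num_real //.
set v := `|w|; have v0 : 0 <= v by exact: normr_ge0.
have p2 := @pi_ge2 R; have p0 := pi_gt0 R.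
have -> : 2 * pi * v / 2 = pi * v by field.
have : pi * v / 2 <= sin (pi * v) by apply: sin_lower_bound; rewrite -/v in wle; nra.
move=> h; have : v <= sin (pi * v) by nra.
by move=> ?; nra.
Qed.

Lemma cosD2piz a (z : int) : cos (a + 2 * pi * z%:~R) = cos a.
Proof.
have hn (b : R) (n : nat) : cos (b + 2 * pi * n%:R) = cos b.
  rewrite -(periodicn (@cosD2pi R) n b); congr (cos (_ + _)).
  by rewrite -[RHS]mulr_natr -[pi *+ 2]mulr_natr [2 * pi]mulrC.
case: z => n; first exact: hn.
by rewrite NegzE rmorphN /= -(hn _ n.+1) -pmulrn; congr cos; ring.
Qed.

Lemma le_expR2N (u : R) : 0 <= u <= 1 / 2 -> expR (- (2 * u)) <= 1 - u.
Proof.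
move=> u01; have := expR_ge1Dx (2 * u).
rewrite expRN => h.
have e0 := expR_gt0 (2 * u).
rewrite -[leLHS]mul1r ler_pdivrMr //; nra.
Qed.

(* Characteristic function of a single entry of [H], at frequency [2 pi y]. *)
Definition psi y : R := 3 / 4 + cos (2 * pi * y) / 4.

(** Positivity comes from the mass 3/4 at 0. It is what allows products of [psi] to be used as
    nonnegative weights. *)
Lemma psi_ge y : 1 / 2 <= psi y.
Proof. by rewrite /psi; have := cos_geN1 (2 * pi * y); lra. Qed.

Lemma psi_gt0 y : 0 < psi y.
Proof. by have := psi_ge y; lra. Qed.

Lemma psi_lower y : expR (- (16 * y ^+ 2)) <= psi y.
Proof.
pose u := (1 - cos (2 * pi * y)) / 4.
have hu : 0 <= u <= 1 / 2.
  by rewrite /u; have := cos_geN1 (2 * pi * y); have := cos_le1 (2 * pi * y); lra.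
have -> : psi y = 1 - u by rewrite /psi /u; field.
apply: le_trans (le_expR2N hu); rewrite ler_expR lerN2.
have := one_sub_cos_le (2 * pi * y).
have p4 : pi <= 4 :> R by have := @pihalf_lt2 R; lra.
have p0 := pi_gt0 R.
have : pi ^+ 2 <= 16 :> R by nra.
rewrite /u !exprMn => h1 h2.
have y2 : 0 <= y ^+ 2 by exact: sqr_ge0.
nra.
Qed.

Lemma psiDz y (z : int) : psi (y + z%:~R) = psi y.
Proof. by rewrite /psi mulrDr cosD2piz. Qed.

Lemma psi_upper_half y : `|y| <= 1 / 2 -> psi y <= expR (- (y ^+ 2 / 2)).
Proof.
move=> /one_sub_cos_ge h; apply: le_trans (expR_ge1Dx _).
by rewrite /psi; lra.
Qed.

Lemma psi_upper y : exists z : int, psi y <= expR (- ((y - z%:~R) ^+ 2 / 2)).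
Proof.
exists (Num.floor (y + 1 / 2)).
set z := Num.floor _.
have /andP[h1 h2] : z%:~R <= y + 1 / 2 < (z + 1)%:~R by rewrite floor_le_tmp ?floorD1_gt.
rewrite -[in leLHS](subrK z%:~R y) psiDz; apply: psi_upper_half.
rewrite ler_norml; rewrite intrD in h2; lra.
Qed.

End Trigonometry.

(** ** Expectation over i.i.d. entries *)

Section Expectation.
Variables (R : realType) (T : finType).
Implicit Types (f g : (T -> R) -> R) (x : T -> R) (j : T).

Definition esp f : R :=
  \sum_(s : {ffun T -> 'I_3})
     (\prod_j entry_weight R (s j)) * f (fun j => entry_val R (s j)).

Definition upd x j (v : R) : T -> R := fun i => if i == j then v else x i.

Lemma sum_entry (g : R -> R) :
  \sum_(t < 3) entry_weight R t * g (entry_val R t) =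
  g (-1) / 8 + g 0 * (3 / 4) + g 1 / 8.
Proof.
rewrite !big_ord_recl big_ord0 /entry_weight /entry_val /=.
by rewrite /bump /= sub0r subrr (_ : 2%:R - 1 = 1 :> R); [field | ring].
Qed.

Lemma entry_weight_gt0 t : 0 < entry_weight R t.
Proof. by rewrite /entry_weight; case: ifP => _; lra. Qed.

Lemma sum_entry_weight : \sum_(t < 3) entry_weight R t = 1.
Proof.
rewrite -[RHS](_ : \sum_(t < 3) entry_weight R t * 1 = 1).
  by apply: eq_bigr => t _; rewrite mulr1.
by rewrite (sum_entry (fun=> 1)); field.
Qed.

Lemma norm_entry_val t : `|entry_val R t| <= 1.
Proof.
by rewrite /entry_val; case: t => -[|[|[|//]]] /= _;
  rewrite ler_norml; lra.
Qed.

Lemma ler_esp f g : (forall x, (forall j, `|x j| <= 1) -> f x <= g x) ->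
  esp f <= esp g.
Proof.
move=> h; apply: ler_sum => s _; apply: ler_wpM2l.
  by apply: prodr_ge0 => j _; exact/ltW/entry_weight_gt0.
by apply: h => j; exact: norm_entry_val.
Qed.

Lemma eq_esp f g : f =1 g -> esp f = esp g.
Proof. by move=> h; apply: eq_bigr => s _; rewrite h. Qed.

Lemma espZ (c : R) f : esp (fun x => c * f x) = c * esp f.
Proof. by rewrite /esp mulr_sumr; apply: eq_bigr => s _; rewrite mulrCA. Qed.

Lemma espD f g : esp (fun x => f x + g x) = esp f + esp g.
Proof. by rewrite /esp -big_split; apply: eq_bigr => s _; rewrite /= mulrDr. Qed.

Lemma esp_sum (I : Type) (r : seq I) (P : pred I) (F : I -> (T -> R) -> R) :
  esp (fun x => \sum_(i <- r | P i) F i x) = \sum_(i <- r | P i) esp (F i).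
Proof. by rewrite /esp exchange_big; apply: eq_bigr => s _; rewrite mulr_sumr. Qed.

Lemma esp_cst (c : R) : esp (fun=> c) = c.
Proof.
rewrite /esp -mulr_suml -(bigA_distr_bigA (fun _ => entry_weight R)).
by rewrite big1 ?mul1r // => j _; exact: sum_entry_weight.
Qed.

Lemma esp_ge0 f : (forall x, 0 <= f x) -> 0 <= esp f.
Proof. by move=> h; rewrite -[leLHS](esp_cst 0); apply: ler_esp => x _. Qed.

(** Invariance of the product measure under exchanging coordinate [j] with an independent copy: the
    involution [inv] swaps [s j] with the fresh value [t]. *)
Lemma esp_resample j f :
  esp f = esp (fun x => f (upd x j (-1)) / 8 + f (upd x j 0) * (3 / 4)
                        + f (upd x j 1) / 8).
Proof.
pose ups (s : {ffun T -> 'I_3}) t : {ffun T -> 'I_3} :=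
  [ffun i => if i == j then t else s i].
pose F (s : {ffun T -> 'I_3}) := f (fun i => entry_val R (s i)).
pose W (s : {ffun T -> 'I_3}) := \prod_i entry_weight R (s i).
transitivity (\sum_(p : {ffun T -> 'I_3} * 'I_3)
                W p.1 * entry_weight R p.2 * F p.1).
  rewrite -(pair_bigA _ (fun s t => W s * entry_weight R t * F s)) /=.
  apply: eq_bigr => s _; rewrite -mulr_suml -mulr_sumr.
  by rewrite sum_entry_weight mulr1.
pose inv (p : {ffun T -> 'I_3} * 'I_3) := (ups p.1 p.2, p.1 j).
have invK : involutive inv.
  move=> [s t]; rewrite /inv /=; congr pair; last by rewrite ffunE eqxx.
  by apply/ffunP => i; rewrite !ffunE; case: eqP => // ->.
rewrite (reindex_inj (inv_inj invK)) /=.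
rewrite -(pair_bigA _ (fun s t => W (ups s t) * entry_weight R (s j) * F (ups s t))).
apply: eq_bigr => s _ /=.
rewrite -(sum_entry (fun v => f (upd (fun i => entry_val R (s i)) j v))) mulr_sumr.
apply: eq_bigr => t _.
have -> : F (ups s t) = f (upd (fun i => entry_val R (s i)) j (entry_val R t)).
  by congr f; apply/funext => i; rewrite ffunE /upd; case: eqP.
rewrite mulrA; congr (_ * _); rewrite /W (bigD1 j) //= [in RHS](bigD1 j) //=.
rewrite ffunE eqxx.
under eq_bigr => i ij do rewrite ffunE (negPf ij).
ring.
Qed.

Lemma sum_upd_notin (u x : T -> R) j v (r : seq T) : j \notin r ->
  \sum_(i <- r) u i * upd x j v i = \sum_(i <- r) u i * x i.
Proof.
move=> jr; apply: eq_big_seq => i ir; rewrite /upd; case: eqP => // ij.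
by rewrite -ij ir in jr.
Qed.

(** The phase [a] makes the induction close without complex exponentials: integrating out one
    coordinate shifts the phase by plus or minus the same angle, and the sine terms cancel by
    symmetry. *)
Lemma esp_cos (a : R) (u : T -> R) :
  esp (fun x => cos (a + 2 * pi * \sum_j u j * x j)) = cos a * \prod_j psi (u j).
Proof.
elim: (index_enum T) (index_enum_uniq T) => [_|j r IH /= /andP[jr ur]].
  rewrite big_nil mulr1 -[RHS]esp_cst; apply: eq_esp => x.
  by rewrite big_nil mulr0 addr0.
rewrite big_cons mulrCA -IH // (esp_resample j) -espZ; apply: eq_esp => x.
rewrite !big_cons !(sum_upd_notin _ _ _ jr) /upd eqxx /psi.
set S := \sum_(i <- r) _; set b := a + 2 * pi * S.
have e v : a + 2 * pi * (u j * v + S) = b + 2 * pi * u j * v by rewrite /b; ring.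
by rewrite !e !mulr0 !addr0 mulr1 mulrN1 cosB cosD; field.
Qed.

End Expectation.

Lemma esp_exchange (R : realType) (T I : finType) (F : (T -> R) -> (I -> R) -> R) :
  esp (fun x => esp (F x)) = esp (fun y => esp (F^~ y)).
Proof.
rewrite /esp; under eq_bigr do rewrite mulr_sumr; rewrite exchange_big /=.
by apply: eq_bigr => s _; rewrite mulr_sumr; apply: eq_bigr => t _; rewrite mulrCA.
Qed.

(** ** Exponential moments of quadratic forms *)

Section Gibbs.
Variables (R : realType) (T I : finType) (B : T -> I -> R).
Implicit Types (x : T -> R) (j : T) (i : I) (b : R).

Definition tmulv x i : R := \sum_j B j i * x j.
Definition qform x : R := \sum_i tmulv x i ^+ 2.
Definition hs2 : R := \sum_j \sum_i B j i ^+ 2.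

Hypothesis contr : forall x, qform x <= \sum_j x j ^+ 2.

(** As a function of coordinate [j] alone, [qform] is the polynomial [|y|^2 + 2 h t + a t^2] in
    [t = x j]. The local field [h x j] does not depend on [x j], so it is unchanged by
    resampling. *)
Let a j : R := \sum_i B j i ^+ 2.
Let y x j i : R := tmulv x i - B j i * x j.
Let h x j : R := \sum_i B j i * y x j i.

Lemma qform_ge0 x : 0 <= qform x.
Proof. by apply: sumr_ge0 => i _; exact: sqr_ge0. Qed.

Lemma hs2_ge0 : 0 <= hs2.
Proof. by apply: sumr_ge0 => j _; apply: sumr_ge0 => i _; exact: sqr_ge0. Qed.

Let tmulv_upd x j v i : tmulv (upd x j v) i = y x j i + B j i * v.
Proof.
rewrite /y /tmulv (bigD1 j) //= [in RHS](bigD1 j) //= /upd eqxx.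
under eq_bigr => k kj do rewrite (negPf kj).
ring.
Qed.

Let y_upd x j v i : y (upd x j v) j i = y x j i.
Proof. by rewrite {1}/y tmulv_upd /upd eqxx addrK. Qed.

Let h_upd x j v : h (upd x j v) j = h x j.
Proof. by apply: eq_bigr => i _; rewrite y_upd. Qed.

Let qform_upd x j v :
  qform (upd x j v) = (\sum_i y x j i ^+ 2) + 2 * v * h x j + v ^+ 2 * a j.
Proof.
rewrite /qform /h /a !mulr_sumr -!big_split; apply: eq_bigr => i _ /=.
by rewrite tmulv_upd; ring.
Qed.

Let sum_mulBt x : \sum_j x j * (\sum_i B j i * tmulv x i) = qform x.
Proof.
under eq_bigr do rewrite mulr_sumr; rewrite exchange_big /=.
apply: eq_bigr => i _.
rewrite expr2 -[X in _ = X * _]/(\sum_j B j i * x j) mulr_suml.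
by apply: eq_bigr => j _; ring.
Qed.

Let qform_coord x : qform x = \sum_j (x j * h x j + a j * x j ^+ 2).
Proof.
rewrite -sum_mulBt; apply: eq_bigr => j _.
rewrite mulrC /h /a !mulr_sumr mulr_suml mulr_suml -big_split; apply: eq_bigr => i _.
by rewrite /y /=; ring.
Qed.

Let a_ge0 j : 0 <= a j.
Proof. by apply: sumr_ge0 => i _; exact: sqr_ge0. Qed.

Let a_le1 j : a j <= 1.
Proof.
have := contr (fun k => (k == j)%:R).
rewrite /qform (bigD1 j) //= eqxx [X in _ + X]big1 => [|k /negPf->]; last by rewrite expr0n.
rewrite expr1n addr0; apply: le_trans; apply: ler_sum => i _.
rewrite /tmulv (bigD1 j) //= eqxx [X in _ + X]big1 => [|k /negPf->]; last by rewrite mulr0.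
by rewrite mulr1 addr0.
Qed.

(** With [z = B B^T x], expand [|B^T (x - z)|^2 >= 0] and bound [|B^T z|^2] by [|z|^2]. No operator
    norm is needed; [contr_tr] uses the same device. *)
Lemma sum_sqr_mulBt x : \sum_j (\sum_i B j i * tmulv x i) ^+ 2 <= qform x.
Proof.
pose z j := \sum_i B j i * tmulv x i.
have : 0 <= \sum_i (tmulv x i - tmulv z i) ^+ 2.
  by apply: sumr_ge0 => i _; exact: sqr_ge0.
have -> : \sum_i (tmulv x i - tmulv z i) ^+ 2 =
    qform x - 2 * (\sum_i tmulv x i * tmulv z i) + qform z.
  rewrite /qform mulr_sumr -sumrN -!big_split; apply: eq_bigr => i _ /=; ring.
have -> : \sum_i tmulv x i * tmulv z i = \sum_j z j ^+ 2.
  under eq_bigr => i _ do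
    rewrite -[X in _ * X]/(\sum_j B j i * z j) mulr_sumr.
  rewrite exchange_big /=.
  apply: eq_bigr => j _; rewrite expr2 -[X in _ = X * _]/(\sum_i B j i * tmulv x i) mulr_suml.
  by apply: eq_bigr => i _; ring.
by have := contr z; rewrite -/z; lra.
Qed.

Let sum_h2 x : (forall j, `|x j| <= 1) ->
  \sum_j h x j ^+ 2 <= 2 * qform x + 2 * hs2.
Proof.
move=> x1.
apply: (@le_trans _ _ (2 * (\sum_j (\sum_i B j i * tmulv x i) ^+ 2) + 2 * hs2)); last first.
  by rewrite lerD2r ler_pM2l // sum_sqr_mulBt.
rewrite /hs2 !mulr_sumr -big_split /=; apply: ler_sum => j _.
rewrite -/(a j).
have -> : h x j = (\sum_i B j i * tmulv x i) - a j * x j.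
  rewrite /h /a mulr_suml -sumrB; apply: eq_bigr => i _; rewrite /y; ring.
set u := \sum_i _.
have x2 : x j ^+ 2 <= 1 by rewrite -[x j ^+ 2]real_normK ?num_real // expr_le1.
have a0 := a_ge0 j; have a1 := a_le1 j.
have h1 : (a j * x j) ^+ 2 <= a j.
  rewrite exprMn; have : a j ^+ 2 <= a j by rewrite expr2 ler_piMl.
  have := sqr_ge0 (a j); nra.
have := sqr_ge0 (u + a j * x j); nra.
Qed.

Let expR_sub_le (u v : R) : expR u - expR v <= `|u - v| * (expR u + expR v).
Proof.
have := expR_ge1Dx (v - u).
rewrite expRB -(ler_pM2r (expR_gt0 u)) mulfVK ?gt_eqF ?expR_gt0 // => hv.
have eu := expR_gt0 u; have ev := expR_gt0 v.
have h1 := ler_norm (u - v); have h0 := normr_ge0 (u - v).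
nra.
Qed.

(* [P] and [M] are the Gibbs weights of the values [1] and [-1] of one
   coordinate, [Z] that of the value [0]. *)
Let three_point b z0 k (c : R) : `|b| <= 1 / 16 -> 0 <= c <= 1 ->
  let P := expR (- b * (z0 + 2 * k + c)) in
  let M := expR (- b * (z0 - 2 * k + c)) in
  let Z := expR (- b * z0) in
  let S := M / 8 + Z * (3 / 4) + P / 8 in
  (c / 5 - 4 * `|b| * k ^+ 2) * S <= ((c - k) * M + (c + k) * P) / 8 /\
  ((c - k) * M + (c + k) * P) / 8 <= (c + 4 * `|b| * k ^+ 2) * S.
Proof.
move=> b16 /andP[c0 c1] P M Z S.
have P0 : 0 < P := expR_gt0 _.
have M0 : 0 < M := expR_gt0 _.
have Z0 : 0 < Z := expR_gt0 _.
have bc : b * c <= 1 / 16.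
  by apply: le_trans (ler_norm _) _; rewrite normrM (ger0_norm c0); nra.
(* By convexity [P + M >= Z (2 - 2 b c)]. Hence the values 1 and -1 carry between a fifth and all of
   the mass [S], which is the origin of [c / 5] and [c]; the odd part [k (P - M)] is the error
   term. *)
have hS : Z * (3 / 2) <= P + M.
  have -> : P = Z * expR (- b * (2 * k + c)) by rewrite /P /Z -expRD; congr expR; ring.
  have -> : M = Z * expR (- b * (- 2 * k + c)) by rewrite /M /Z -expRD; congr expR; ring.
  rewrite -mulrDr ler_pM2l //.
  have := expR_ge1Dx (- b * (2 * k + c)); have := expR_ge1Dx (- b * (- 2 * k + c)).
  nra.
have kd : `|k * (P - M)| <= 4 * `|b| * k ^+ 2 * (P + M).
  rewrite normrM -[k ^+ 2]real_normK ?num_real //.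
  have : `|P - M| <= 4 * `|b| * `|k| * (P + M).
    have e : `|- b * (z0 + 2 * k + c) - (- b * (z0 - 2 * k + c))| = 4 * `|b| * `|k|.
      rewrite (_ : _ - _ = (- 4) * b * k); last ring.
      by rewrite !normrM normrN [`|4|]ger0_norm.
    rewrite ler_norml -e; apply/andP; split; last exact: expR_sub_le.
    by rewrite lerNl opprB distrC [P + M]addrC; exact: expR_sub_le.
  have := normr_ge0 k; nra.
have hS1 : S <= (P + M) * (5 / 8) by rewrite /S; lra.
have hS2 : (P + M) / 8 <= S by rewrite /S; lra.
have q0 : 0 <= 4 * `|b| * k ^+ 2 by rewrite mulr_ge0 ?sqr_ge0 // mulr_ge0.
move: kd q0; set q := 4 * _ * _; rewrite ler_norml => /andP[k1 k2] q0.
have -> : (c - k) * M + (c + k) * P = c * (P + M) + k * (P - M) by ring.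
split; nra.
Qed.

Let gibbs_coord b j : `|b| <= 1 / 16 ->
  let w x := expR (- b * qform x) in
  esp (fun x => (a j * (1 / 5) + - (4 * `|b|) * h x j ^+ 2) * w x)
    <= esp (fun x => (x j * h x j + a j * x j ^+ 2) * w x) /\
  esp (fun x => (x j * h x j + a j * x j ^+ 2) * w x)
    <= esp (fun x => (a j * 1 + 4 * `|b| * h x j ^+ 2) * w x).
Proof.
move=> b16 w.
have aj : 0 <= a j <= 1 by rewrite a_ge0 a_le1.
have q0 x : qform (upd x j 0) = \sum_i y x j i ^+ 2.
  by rewrite qform_upd expr0n /= mul0r mulr0 mul0r !addr0.
have q1 x : qform (upd x j 1) = (\sum_i y x j i ^+ 2) + 2 * h x j + a j.
  by rewrite qform_upd expr1n mul1r mulr1.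
have qN1 x : qform (upd x j (- 1)) = (\sum_i y x j i ^+ 2) - 2 * h x j + a j.
  by rewrite qform_upd sqrrN expr1n mul1r mulrN1 mulNr.
split; rewrite [leLHS](esp_resample j) [leRHS](esp_resample j);
  apply: ler_esp => x _; rewrite !h_upd /w q0 q1 qN1 /upd eqxx;
  have [] := three_point (\sum_i y x j i ^+ 2) (h x j) b16 aj;
  rewrite !mul0r sqrrN expr1n expr0n !mulr0 !mulr1 !mul1r !mulNr !addr0 mul0r;
  set P := expR _; set M := expR _; set Z := expR _.
- lra.
- lra.
Qed.

(* The mean of [qform] under the Gibbs measure of density [expR (- b * qform)],
   estimated by resampling one coordinate at a time. It controls the logarithmic
   derivative in [b] of the partition function, hence the next two lemmas. *)
Lemma gibbs_energy b : `|b| <= 1 / 16 ->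
  let w x := expR (- b * qform x) in
  (1 / 5 - 8 * `|b|) * hs2 * esp w <= (1 + 8 * `|b|) * esp (fun x => qform x * w x) /\
  (1 - 8 * `|b|) * esp (fun x => qform x * w x) <= (1 + 8 * `|b|) * hs2 * esp w.
Proof.
move=> b16 w.
have w0 x : 0 < w x by exact: expR_gt0.
have -> : esp (fun x => qform x * w x) =
    \sum_j esp (fun x => (x j * h x j + a j * x j ^+ 2) * w x).
  by rewrite -esp_sum; apply: eq_esp => x; rewrite {1}qform_coord mulr_suml.
set E := \sum_j _.
have EE : E = esp (fun x => qform x * w x).
  by rewrite /E -esp_sum; apply: eq_esp => x; rewrite [X in _ = X * _]qform_coord mulr_suml.
have h2 : esp (fun x => (\sum_j h x j ^+ 2) * w x) <= 2 * E + 2 * hs2 * esp w.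
  rewrite EE -!espZ -espD; apply: ler_esp => x x1; rewrite mulrA -mulrDl.
  by rewrite ler_pM2r // sum_h2.
have b0 := normr_ge0 b.
have sumE c s : \sum_j esp (fun x => (a j * c + s * h x j ^+ 2) * w x) =
    c * hs2 * esp w + s * esp (fun x => (\sum_j h x j ^+ 2) * w x).
  rewrite -esp_sum -!espZ -espD; apply: eq_esp => x.
  by rewrite -mulr_suml big_split /= -mulr_suml -mulr_sumr -/hs2; ring.
have := ler_sum (index_enum T) (P := xpredT) (fun j _ => (gibbs_coord j b16).1).
have := ler_sum (index_enum T) (P := xpredT) (fun j _ => (gibbs_coord j b16).2).
rewrite !sumE -/E => H2 H1; split; nra.
Qed.

Let expR_le1D2 (u : R) : 0 <= u <= 1 / 2 -> expR u <= 1 + 2 * u.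
Proof.
move=> u01; have := expR_ge1Dx (- u); rewrite expRN => hu.
have e0 := expR_gt0 u.
have : (1 - u) * expR u <= 1 by rewrite -ler_pdivlMr // mul1r.
nra.
Qed.

(** For [g b], the mean of [expR (- b * qform)], [gibbs_energy] gives [- g' >= hs2 / 11 * g] on
    [[0, 1/80]]. This is integrated by [M] discrete steps, each using only [1 + x <= exp x]. The
    factor 2 lost in [expR_le1D2] turns 11 into 22, and [1760 = 80 * 22]. *)
Lemma small_ball_exp : esp (fun x => expR (- (qform x / 80))) <= expR (- (hs2 / 1760)).
Proof.
have h0 := hs2_ge0.
pose M := (Num.truncn hs2).+1.
have hM : hs2 <= M%:R by apply/ltW/truncnS_gt.
have M0 : 0 < M%:R :> R by rewrite ltr0n.
pose del : R := 1 / 80 / M%:R.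
have d0 : 0 < del by rewrite !divr_gt0.
have Md : M%:R * del = 1 / 80 by rewrite /del; field; rewrite gt_eqF.
pose g b := esp (fun x => expR (- b * qform x)).
have g0 b : 0 <= g b by apply: esp_ge0 => x; exact: expR_ge0.
pose u := del * hs2 / 22.
have u1 : 0 <= u <= 1 / 2.
  rewrite /u /del; apply/andP; split; first by rewrite !mulr_ge0 // ?invr_ge0 ltW.
  have : hs2 / M%:R <= 1 by rewrite ler_pdivrMr // mul1r.
  lra.
have step b : 0 <= b <= 1 / 80 -> expR u * g b <= g (b - del).
  move=> /andP[b0 b80].
  have b16 : `|b| <= 1 / 16 by rewrite ger0_norm //; lra.
  have [H _] := gibbs_energy b16.
  move: H; rewrite (ger0_norm b0) -/(g b); set E := esp _ => H.
  have H1 : hs2 / 11 * g b <= E.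
    have := mulr_ge0 h0 (g0 b) => p0; have E0 : 0 <= E.
      by apply: esp_ge0 => x; rewrite mulr_ge0 ?expR_ge0 ?qform_ge0.
    nra.
  have H2 : g b + del * E <= g (b - del).
    rewrite /E -espZ -espD; apply: ler_esp => x _.
    have -> : - (b - del) * qform x = - b * qform x + del * qform x by ring.
    rewrite expRD; have := expR_ge1Dx (del * qform x).
    have := expR_gt0 (- b * qform x); nra.
  have := ler_wpM2r (g0 b) (expR_le1D2 u1).
  have := ler_wpM2l (ltW d0) H1; rewrite /u; lra.
have iter m : (m <= M)%N -> expR (m%:R * u) * g (m%:R * del) <= 1.
  elim: m => [_|m IH mM].
    rewrite mul0r expR0 mul1r /g mul0r -[leRHS](@esp_cst R T 1).
    by apply: ler_esp => x _; rewrite oppr0 mul0r expR0.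
  apply: le_trans (IH (ltnW mM)).
  rewrite -natr1 mulrDl mul1r expRD -mulrA ler_pM2l ?expR_gt0 //.
  have -> : m%:R * del = (m%:R + 1) * del - del by ring.
  apply: step; rewrite mulr_ge0 ?addr_ge0 ?ler0n //=; last exact: ltW.
  by rewrite -Md ler_pM2r // natr1 ler_nat.
have := iter M (leqnn M); rewrite Md.
have -> : M%:R * u = hs2 / 1760.
  by rewrite /u /del; field; rewrite gt_eqF.
rewrite expRN -ler_pdivlMl ?expR_gt0 // mulr1; apply: le_trans.
by apply: ler_esp => x _; rewrite ler_expR; lra.
Qed.

(** The same integration for the opposite sign of the exponent: up to 1/16 the mean energy is at
    most [3 hs2], which [le_expR2N] doubles, and [3 / 8 = 6 / 16]. *)
Lemma exp_moment : esp (fun x => expR (qform x / 16)) <= expR (hs2 * 3 / 8).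
Proof.
have h0 := hs2_ge0.
pose M := (Num.truncn hs2).+1.
have hM : hs2 <= M%:R by apply/ltW/truncnS_gt.
have M0 : 0 < M%:R :> R by rewrite ltr0n.
pose del : R := 1 / 16 / M%:R.
have d0 : 0 < del by rewrite !divr_gt0.
have Md : M%:R * del = 1 / 16 by rewrite /del; field; rewrite gt_eqF.
pose g b := esp (fun x => expR (b * qform x)).
have g0 b : 0 <= g b by apply: esp_ge0 => x; exact: expR_ge0.
pose u := 3 * del * hs2.
have u1 : 0 <= u <= 1 / 2.
  rewrite /u /del; apply/andP; split; first by rewrite !mulr_ge0 // ?invr_ge0 ltW.
  have : hs2 / M%:R <= 1 by rewrite ler_pdivrMr // mul1r.
  lra.
have step b : 0 <= b <= 1 / 16 -> expR (- (2 * u)) * g b <= g (b - del).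
  move=> /andP[b0 b16].
  have b16' : `|- b| <= 1 / 16 by rewrite normrN ger0_norm.
  have [_] := gibbs_energy b16'.
  rewrite normrN (ger0_norm b0) opprK -/(g b); set E := esp _ => H.
  have H1 : E <= 3 * hs2 * g b.
    have := mulr_ge0 h0 (g0 b) => p0; have E0 : 0 <= E.
      by apply: esp_ge0 => x; rewrite mulr_ge0 ?expR_ge0 ?qform_ge0.
    nra.
  have H2 : g b + (- del) * E <= g (b - del).
    rewrite /E -espZ -espD; apply: ler_esp => x _.
    have -> : (b - del) * qform x = b * qform x + (- del) * qform x by ring.
    rewrite expRD; have := expR_ge1Dx ((- del) * qform x).
    have := expR_gt0 (b * qform x); nra.
  have := ler_wpM2r (g0 b) (le_expR2N u1).
  have := ler_wpM2l (ltW d0) H1; rewrite /u; lra.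
have iter m : (m <= M)%N -> g (m%:R * del) <= expR (m%:R * (2 * u)).
  elim: m => [_|m IH mM].
    rewrite !mul0r expR0 /g -[leRHS](@esp_cst R T 1).
    by apply: ler_esp => x _; rewrite mul0r expR0.
  rewrite -[in leRHS]natr1 mulrDl mul1r expRD -ler_pdivrMr ?expR_gt0 // -expRN.
  apply: le_trans (IH (ltnW mM)); rewrite mulrC.
  have -> : m%:R * del = m.+1%:R * del - del by rewrite -natr1; ring.
  apply: step; rewrite mulr_ge0 ?ler0n //=; last exact: ltW.
  by rewrite -Md ler_pM2r // ler_nat.
have := iter M (leqnn M); rewrite Md.
have -> : M%:R * (2 * u) = hs2 * 3 / 8.
  by rewrite /u /del; field; rewrite gt_eqF.
apply: le_trans.
by apply: ler_esp => x _; rewrite ler_expR; lra.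
Qed.

End Gibbs.

(** ** Smoothing by characters *)

Section Characters.
Variables (R : realType) (T I : finType) (B : T -> I -> R).
Implicit Types (x u : T -> R) (xi : I -> R).

Definition mulv xi j : R := \sum_i B j i * xi i.
(* A substitute for the Gaussian weight [expR (- qform B x)] that is a finite
   convex combination of characters, see [esp_char_weight]. *)
Definition weight x : R := \prod_i psi (tmulv B x i).
(** The Fourier transform of [weight] at frequency [u], as [esp_char_weight] shows. *)
Definition smoothed u : R := esp (fun xi => \prod_j psi (u j + mulv xi j)).

Hypothesis contr : forall x, qform B x <= \sum_j x j ^+ 2.
Hypothesis small : forall x, (forall j, `|x j| <= 1) -> forall i, `|tmulv B x i| <= 1 / 2.

Lemma weight_ge0 x : 0 <= weight x.
Proof. by apply: prodr_ge0 => i _; exact/ltW/psi_gt0. Qed.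

Lemma esp_char_weight a u :
  esp (fun x => cos (a + 2 * pi * \sum_j u j * x j) * weight x) = cos a * smoothed u.
Proof.
transitivity (esp (fun x => esp (fun xi =>
    cos (a + 2 * pi * \sum_j (u j + mulv xi j) * x j)))).
  apply: eq_esp => x; rewrite -esp_cos; apply: eq_esp => xi.
  rewrite -addrA -mulrDr; congr (cos (_ + _ * _)).
  under [RHS]eq_bigr do rewrite mulrDl.
  rewrite big_split /=; congr (_ + _).
  under eq_bigr do rewrite mulr_suml; under [RHS]eq_bigr do rewrite mulr_suml.
  rewrite exchange_big /=; apply: eq_bigr => j _; apply: eq_bigr => i _; ring.
rewrite esp_exchange /smoothed -espZ; apply: eq_esp => xi; exact: esp_cos.
Qed.

Lemma weight_lower x : expR (- (16 * qform B x)) <= weight x.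
Proof.
rewrite /qform mulr_sumr -sumrN expR_sum; apply: ler_prod => i _.
by rewrite expR_ge0 psi_lower.
Qed.

Lemma smoothed_ge0 u : 0 <= smoothed u.
Proof. by apply: esp_ge0 => xi; apply: prodr_ge0 => i _; exact/ltW/psi_gt0. Qed.

(** The transform of a nonnegative weight is largest at 0. The hypothesis [small] keeps each
    argument of [psi] within half a period, where [psi] is below a Gaussian. *)
Lemma smoothed_le u : smoothed u <= expR (- (hs2 B / 1760)).
Proof.
rewrite -[leLHS]mul1r -[X in X * _]cos0 -esp_char_weight.
apply: le_trans (small_ball_exp contr); apply: ler_esp => x x1.
apply: (@le_trans _ _ (weight x)); first by rewrite ler_piMl ?weight_ge0 ?cos_le1.
rewrite /qform mulr_suml -sumrN expR_sum; apply: ler_prod => i _.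
rewrite ltW ?psi_gt0 //=; apply: le_trans (psi_upper_half (small x1 i)) _.
by rewrite ler_expR; have := sqr_ge0 (tmulv B x i); lra.
Qed.

Lemma contr_tr xi : \sum_j mulv xi j ^+ 2 <= \sum_i xi i ^+ 2.
Proof.
set v := mulv xi.
have : 0 <= \sum_i (xi i - tmulv B v i) ^+ 2.
  by apply: sumr_ge0 => i _; exact: sqr_ge0.
have -> : \sum_i (xi i - tmulv B v i) ^+ 2 =
    \sum_i xi i ^+ 2 - 2 * (\sum_i xi i * tmulv B v i) + qform B v.
  rewrite /qform mulr_sumr -sumrN -!big_split; apply: eq_bigr => i _ /=; ring.
have -> : \sum_i xi i * tmulv B v i = \sum_j v j ^+ 2.
  under eq_bigr do rewrite mulr_sumr; rewrite exchange_big /=.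
  apply: eq_bigr => j _; rewrite expr2 -[X in _ = X * _]/(\sum_i B j i * xi i) mulr_suml.
  by apply: eq_bigr => i _; ring.
by have := contr v; lra.
Qed.

Lemma esp_mulv : esp (fun xi => expR ((\sum_j mulv xi j ^+ 2) / 16)) <= expR (hs2 B * 3 / 8).
Proof.
by have := exp_moment contr_tr; rewrite [hs2 _]exchange_big.
Qed.

(** The random shift [mulv xi] may bring [u] closer to the integers. With [s] the deviation of [u]
    and [t] the shift, [(s + t)^2 / 2 >= s^2 / 32 - t^2 / 16], and the exponential moment of the
    last term is [esp_mulv]. *)
Lemma smoothed_far u (D : R) :
  (forall z : T -> int, D <= \sum_j (u j - (z j)%:~R) ^+ 2) ->
  smoothed u <= expR (hs2 B * 3 / 8 - D / 32).
Proof.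
move=> hD; rewrite expRD mulrC.
apply: le_trans (ler_wpM2l (expR_ge0 _) esp_mulv); rewrite -espZ.
apply: ler_esp => xi _.
pose z j := projT1 (cid (psi_upper (u j + mulv xi j))).
rewrite -expRD; apply: (@le_trans _ _
    (expR (\sum_j - ((u j + mulv xi j - (z j)%:~R) ^+ 2 / 2)))).
  rewrite expR_sum; apply: ler_prod => j _; rewrite ltW ?psi_gt0 //=.
  by rewrite /z; case: cid.
have c0 : 0 <= 1 / 32 :> R by rewrite divr_ge0.
rewrite ler_expR; have := ler_wpM2r c0 (hD z).
move=> h.
apply: (@le_trans _ _ (- ((\sum_j (u j - (z j)%:~R) ^+ 2) * (1 / 32)) + (\sum_j mulv xi j ^+ 2) / 16)).
  rewrite !mulr_suml -sumrN -big_split; apply: ler_sum => j _ /=.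
  set s := u j - _; set t := mulv xi j.
  rewrite (_ : u j + t - _ = s + t); last by rewrite /s; ring.
  by have := sqr_ge0 (s + 2 * t); have := sqr_ge0 (s + t); lra.
by lra.
Qed.

Lemma smoothed_interp u (D : R) : 0 <= D ->
  (forall z : T -> int, D <= \sum_j (u j - (z j)%:~R) ^+ 2) ->
  smoothed u <= expR (- (hs2 B / 3520)) * expR (- (2 ^- 16 * D)).
Proof.
move=> D0 hD; have h1 := smoothed_le u; have h2 := smoothed_far hD.
have h0 := hs2_ge0 B; rewrite -expRD.
(* The minimum of the two exponents is below any convex combination. The weight [32 p = 2^-11] on
   the far bound is small enough that its loss [3/8 hs2] consumes less than half of the gain
   [hs2 / 1760]. *)
set p : R := 2 ^- 16.
have hp : p * 2 ^+ 16 = 1 by rewrite mulVf ?expf_neq0 ?pnatr_eq0.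
clearbody p.
have p0 : 0 < 32 * p < 1 by apply/andP; split; lra.
set a := - (hs2 B / 1760) in h1; set b := hs2 B * 3 / 8 - D / 32 in h2.
have ab : a * (1 - 32 * p) + b * (32 * p) <= - (hs2 B / 3520) + - (p * D).
  by have : hs2 B * (p * 32 / 1760 + 12 * p - 1 / 3520) <= 0; [apply: mulr_ge0_le0; lra | rewrite /a /b; lra].
have : Num.min a b <= a * (1 - 32 * p) + b * (32 * p).
  by rewrite ge_min; apply/orP; have [le_ab|lt_ba] := leP a b; [left|right]; nra.
rewrite ge_min => /orP[h|h].
- by apply: le_trans h1 _; rewrite ler_expR; apply: le_trans h ab.
- by apply: le_trans h2 _; rewrite ler_expR; apply: le_trans h ab.
Qed.

End Characters.

(** ** Fejer kernels *)

Lemma half_exp_ge0 (R : realType) (n : nat) : 0 <= (1 / 2 : R) ^+ n.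
Proof. by rewrite exprn_ge0 // divr_ge0. Qed.

(** With truncated subtraction the exponent is [|a - b|]. The bound [1 + x] is not inductive in [L];
    [g] is the closed form of the two geometric sums, up to a dropped term [x^(a+1)]. *)
Lemma sum_exp_dist (R : realType) (x : R) (L a : nat) : 0 <= x <= 1 ->
  (1 - x) * \sum_(b < L) x ^+ ((a - b) + (b - a)) <= 1 + x.
Proof.
move=> /andP[x0 x1].
pose g (b : nat) : R := if (b <= a)%N then x * x ^+ (a - b) else 1 + x - x ^+ (b - a).
have e0 n : 0 <= x ^+ n by rewrite exprn_ge0.
have e1 n : x ^+ n <= 1 by rewrite exprn_ile1.
suff : (1 - x) * \sum_(b < L) x ^+ ((a - b) + (b - a)) <= g L.
  move=> /le_trans; apply; rewrite /g; case: ifP => _.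
    by have := e1 (a - L)%N; have := e0 (a - L)%N; nra.
  by have := e0 (L - a)%N; lra.
elim: L => [|L IH]; first by rewrite big_ord0 mulr0 /g leq0n mulr_ge0.
rewrite big_ord_recr /= mulrDr.
suff : g L + (1 - x) * x ^+ (a - L + (L - a)) <= g L.+1 by lra.
rewrite /g; have [lt|gt|->] := ltngtP L a.
- rewrite (eqP (ltnW lt : (L - a == 0)%N)) addn0.
  have -> : (a - L = (a - L.+1).+1)%N by rewrite subnSK.
  by rewrite exprS; lra.
- rewrite (eqP (ltnW gt : (a - L == 0)%N)).
  by rewrite add0n subSn ?(ltnW gt) // exprS; lra.
by rewrite subnn subSn // subnn expr0 expr1; lra.
Qed.

Section Fejer.
Variables (R : realType) (L C : nat) (eta : R).
Hypothesis L0 : (0 < L)%N.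
Implicit Types y : R.

Definition fejer y : R :=
  L%:R ^- 2 * \sum_(a < L) \sum_(b < L) cos (2 * pi * ((a%:R - b%:R) * eta * y)).

Lemma fejer_ge0 y : 0 <= fejer y.
Proof.
rewrite mulr_ge0 ?invr_ge0 ?exprn_ge0 ?ler0n //.
pose z := 2 * pi * (eta * y).
have -> : \sum_(a < L) \sum_(b < L) cos (2 * pi * ((a%:R - b%:R) * eta * y)) =
    (\sum_(a < L) cos (a%:R * z)) ^+ 2 + (\sum_(a < L) sin (a%:R * z)) ^+ 2.
  rewrite !expr2 !mulr_suml -big_split; apply: eq_bigr => a _ /=.
  rewrite !mulr_sumr -big_split; apply: eq_bigr => b _ /=.
  by rewrite -cosB /z; congr cos; ring.
by rewrite addr_ge0 ?sqr_ge0.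
Qed.

(** All frequencies are at most 16, so on a cell of radius 1/128 every phase is within an eighth of
    a turn, where the cosine is at least 1/2. *)
Lemma fejer_ge_half y : (L%:R - 1) * `|eta| <= 16 -> `|y| <= 1 / 128 -> 1 / 2 <= fejer y.
Proof.
move=> Le y1; have LR : 0 < L%:R :> R by rewrite ltr0n.
suff h (a b : 'I_L) : 1 / 2 <= cos (2 * pi * ((a%:R - b%:R) * eta * y)).
  rewrite /fejer [leRHS]mulrC ler_pdivlMr ?exprn_gt0 //.
  have -> : 1 / 2 * L%:R ^+ 2 = \sum_(a < L) \sum_(b < L) (1 / 2 : R).
    by rewrite !sumr_const !card_ord -mulrnA -[RHS]mulr_natr natrM; ring.
  by apply: ler_sum => a _; apply: ler_sum => b _.
set t := (a%:R - b%:R) * eta * y.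
have t8 : `|t| <= 1 / 8.
  have ab : `|a%:R - b%:R : R| <= L%:R - 1.
    have hl (c : 'I_L) : 0 <= c%:R :> R /\ c%:R <= L%:R - 1 :> R.
      split; first exact: ler0n.
    by rewrite lerBrDr natr1 ler_nat.
    by have [a0 a1] := hl a; have [b0 b1] := hl b; rewrite ler_norml; apply/andP; split; lra.
  rewrite /t !normrM; apply: (@le_trans _ _ (16 * (1 / 128))); last lra.
  apply: ler_pM => //; first by rewrite mulr_ge0.
  by apply: le_trans Le; rewrite ler_wpM2r.
have := one_sub_cos_le (2 * pi * t).
have p4 : pi <= 4 :> R by have := @pihalf_lt2 R; lra.
have p0 := pi_gt0 R.
have t2 : t ^+ 2 <= 1 / 64.
  rewrite -[t ^+ 2]real_normK ?num_real //; have := normr_ge0 t; nra.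
have : pi ^+ 2 <= 16 :> R by nra.
move=> /(fun h => ler_pM (sqr_ge0 pi) (sqr_ge0 t) h t2).
by rewrite !exprMn; lra.
Qed.

(* A Fejer kernel vanishes at some points, whereas a lower bound is needed for
   every row of [H]: each cell of width 1/128 gets its own shifted copy, with a
   geometric weight. *)
Definition phase (p : 'I_C * bool) : R := p.1%:R * (-1) ^+ p.2 / 128.
Definition kernel y : R := \sum_(p : 'I_C * bool) (1 / 2) ^+ p.1 * fejer (y - phase p).

Lemma kernel_lower y : (L%:R - 1) * `|eta| <= 16 -> (Num.truncn (128 * `|y|) < C)%N ->
  (1 / 2) ^+ (Num.truncn (128 * `|y|)).+1 <= kernel y.
Proof.
move=> Le cC; set c := Num.truncn _ in cC *.
have /andP[c1 c2] : c%:R <= 128 * `|y| < c.+1%:R by apply: truncn_itv; rewrite mulr_ge0.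
pose p := (Ordinal cC, y < 0).
have hy : `|y - phase p| <= 1 / 128.
  rewrite -natr1 in c2; rewrite /phase /=; have [y0|y0] := ltP y 0.
    by rewrite ltr0_norm // in c1 c2; rewrite expr1 ler_norml; lra.
  by rewrite ger0_norm // in c1 c2; rewrite expr0 ler_norml; lra.
rewrite /kernel (bigD1 p) //= exprSr.
apply: (@le_trans _ _ ((1 / 2) ^+ c * fejer (y - phase p))).
  by rewrite ler_wpM2l ?half_exp_ge0 // fejer_ge_half.
rewrite lerDl sumr_ge0 // => q _; by rewrite mulr_ge0 ?half_exp_ge0 // fejer_ge0.
Qed.

Lemma kernel_ge0 y : 0 <= kernel y.
Proof. by apply: sumr_ge0 => q _; rewrite mulr_ge0 ?half_exp_ge0 // fejer_ge0. Qed.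

Definition kindex : finType := (('I_C * bool) * ('I_L * 'I_L))%type.
Definition kcoef (q : kindex) : R := (1 / 2) ^+ q.1.1 * L%:R ^- 2.
Definition kfreq (q : kindex) : R := q.2.1%:R - q.2.2%:R.

Lemma sum_kindex (F : 'I_C -> bool -> 'I_L -> 'I_L -> R) :
  \sum_(q : kindex) F q.1.1 q.1.2 q.2.1 q.2.2 =
  \sum_(c < C) \sum_(s : bool) \sum_(a < L) \sum_(b < L) F c s a b.
Proof.
rewrite pair_bigA -(pair_bigA _ (fun p r => F p.1 p.2 r.1 r.2)) /=.
by apply: eq_bigr => p _; rewrite pair_bigA.
Qed.

Lemma kernelE y : kernel y = \sum_(q : kindex)
  kcoef q * cos (- (2 * pi * (kfreq q * eta * phase q.1)) + 2 * pi * (kfreq q * eta * y)).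
Proof.
rewrite -(pair_bigA _ (fun (p : 'I_C * bool) (r : 'I_L * 'I_L) => (1 / 2) ^+ p.1 * L%:R ^- 2 * cos (- (2 * pi * ((r.1%:R - r.2%:R) * eta * phase p)) + 2 * pi * ((r.1%:R - r.2%:R) * eta * y)))).
apply: eq_bigr => p _; rewrite /fejer pair_bigA mulr_sumr mulr_sumr.
by apply: eq_bigr => r _ /=; rewrite mulrA; congr (_ * cos _); ring.
Qed.

Let sum_half : \sum_(c < C) (1 / 2 : R) ^+ c <= 2.
Proof.
suff -> : \sum_(c < C) (1 / 2 : R) ^+ c = 2 - 2 * (1 / 2) ^+ C.
  by have := half_exp_ge0 R C; lra.
elim: C => [|n IH]; first by rewrite big_ord0 expr0; lra.
by rewrite big_ord_recr /= IH exprS; lra.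
Qed.

Lemma sum_kcoef : \sum_q kcoef q <= 4.
Proof.
rewrite (sum_kindex (fun c _ _ _ => (1 / 2) ^+ c * L%:R ^- 2)).
have e (c : 'I_C) : \sum_(s : bool) \sum_(a < L) \sum_(b < L) ((1 / 2) ^+ c * L%:R ^- 2 : R) =
    (1 / 2) ^+ c * 2.
  rewrite !sumr_const card_bool !card_ord -!mulrnA -[LHS]mulr_natr !natrM.
  by field; rewrite pnatr_eq0 -lt0n.
by rewrite (eq_bigr _ (fun c _ => e c)) -mulr_suml; have := sum_half; lra.
Qed.

(** The source of the gain: among the [L^2] pairs of frequencies only those near the diagonal
    survive the Gaussian factor, which saves a factor [L]. Replacing [exp (- m^2)] by [2^-m] bounds
    each line by 3. *)
Lemma sum_kcoef_gauss : \sum_q kcoef q * expR (- kfreq q ^+ 2) <= 12 / L%:R.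
Proof.
have LR : 0 < L%:R :> R by rewrite ltr0n.
rewrite (sum_kindex (fun c _ a b => (1 / 2) ^+ c * L%:R ^- 2 * expR (- (a%:R - b%:R) ^+ 2))).
have e (a b : 'I_L) : expR (- (a%:R - b%:R) ^+ 2) <= (1 / 2 : R) ^+ ((a - b) + (b - a)).
  have h (m : nat) : expR (- m%:R ^+ 2) <= (1 / 2 : R) ^+ m.
    apply: (@le_trans _ _ (expR (m%:R * (- 1)))).
      rewrite ler_expR mulrN1 lerN2 -natrX ler_nat.
      by case: m => // m; rewrite expnS expn1 leq_pmulr.
    rewrite expRM_natl lerXn2r ?nnegrE ?expR_ge0 ?divr_ge0 //.
    have := expR_ge1Dx (1 : R); rewrite expRN => e1.
    by rewrite div1r lef_pV2 ?posrE ?expR_gt0 //; lra.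
  have [ab|/ltnW ba] := leqP a b.
    rewrite (eqP (ab : (a - b == 0)%N)) add0n; apply: le_trans (h _).
    by rewrite natrB // ler_expR lerN2 -sqrrN opprB.
  by rewrite (eqP (ba : (b - a == 0)%N)) addn0; apply: le_trans (h _); rewrite natrB.
have s (a : 'I_L) : \sum_(b < L) expR (- (a%:R - b%:R) ^+ 2) <= 3 :> R.
  have h01 : 0 <= (1 / 2 : R) <= 1 by apply/andP; split; lra.
  apply: (@le_trans _ _ (\sum_(b < L) (1 / 2 : R) ^+ ((a - b) + (b - a)))).
    by apply: ler_sum => b _.
  by have := sum_exp_dist L a h01; lra.
apply: (@le_trans _ _ (\sum_(c < C) \sum_(s : bool) \sum_(a < L) (1 / 2 : R) ^+ c * L%:R ^- 2 * 3)).
  apply: ler_sum => c _; apply: ler_sum => t _; apply: ler_sum => a _.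
  by rewrite -mulr_sumr ler_wpM2l // mulr_ge0 ?half_exp_ge0 ?invr_ge0 ?exprn_ge0.
have e1 (c : 'I_C) : \sum_(s : bool) \sum_(a < L) ((1 / 2) ^+ c * L%:R ^- 2 * 3 : R) =
    (1 / 2) ^+ c * (6 / L%:R).
  rewrite !sumr_const card_bool !card_ord -!mulrnA -[LHS]mulr_natr !natrM.
  by field; rewrite gt_eqF.
rewrite (eq_bigr _ (fun c _ => e1 c)) -mulr_suml.
have : 0 <= 6 / L%:R :> R by rewrite divr_ge0.
by have := sum_half; nra.
Qed.

End Fejer.

(** ** The bound for one row *)

Section Row.
Variables (R : realType) (d : nat) (I : finType) (B : 'I_(d + d) -> I -> R).
Variables (v : 'I_d -> R) (L C : nat) (eta A : R).
Implicit Types (x : 'I_(d + d) -> R) (t : R).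

Definition ldot x : R := \sum_i v i * x (lshift d i).
Definition rdot x : R := \sum_i v i * x (rshift d i).

Hypothesis contr : forall x, qform B x <= \sum_j x j ^+ 2.
Hypothesis small : forall x, (forall j, `|x j| <= 1) -> forall i, `|tmulv B x i| <= 1 / 2.
Hypothesis L0 : (0 < L)%N.
Hypothesis etaL : (L%:R - 1) * `|eta| <= 16.
Hypothesis etaV : eta ^+ 2 * \sum_i v i ^+ 2 = 2 ^+ 18.
Hypothesis A0 : 0 <= A.
Hypothesis far : forall t, `|t| <= 16 -> forall z : 'I_d -> int,
  Num.min (t ^+ 2 * (\sum_i v i ^+ 2) / 4) A <= \sum_i (t * v i - (z i)%:~R) ^+ 2.

Definition dilate t1 t2 (j : 'I_(d + d)) : R :=
  match split j with inl i => t1 * v i | inr i => t2 * v i end.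

Let dilate_l t1 t2 i : dilate t1 t2 (lshift d i) = t1 * v i.
Proof. by rewrite /dilate -[lshift d i]/(unsplit (inl i)) unsplitK. Qed.

Let dilate_r t1 t2 i : dilate t1 t2 (rshift d i) = t2 * v i.
Proof. by rewrite /dilate -[rshift d i]/(unsplit (inr i)) unsplitK. Qed.

Let dilate_dot t1 t2 x : \sum_j dilate t1 t2 j * x j = t1 * ldot x + t2 * rdot x.
Proof.
rewrite big_split_ord /= /ldot /rdot !mulr_sumr; congr (_ + _); apply: eq_bigr => i _.
  by rewrite dilate_l mulrA.
by rewrite dilate_r mulrA.
Qed.

(** By [etaV], the frequency [m * eta] has [(m eta)^2 |v|^2 / 4 = 2^16 m^2], which cancels the
    [2^-16] of [smoothed_interp] and leaves [exp (- m^2)]. If either half reaches the cap [A]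
    instead, that half alone suffices for the second summand. *)
Lemma smoothed_dilate (m1 m2 : R) : `|m1 * eta| <= 16 -> `|m2 * eta| <= 16 ->
  smoothed B (dilate (m1 * eta) (m2 * eta)) <=
  expR (- (hs2 B / 3520)) * (expR (- m1 ^+ 2) * expR (- m2 ^+ 2))
  + expR (hs2 B * 3 / 8 - A / 32).
Proof.
move=> h1 h2.
pose V := \sum_i v i ^+ 2; have eVV : eta ^+ 2 * V = 2 ^+ 18 := etaV.
have V0 : 0 <= V by apply: sumr_ge0 => i _; exact: sqr_ge0.
have eV m : (m * eta) ^+ 2 * V / 4 = 2 ^+ 16 * m ^+ 2.
  by rewrite exprMn -mulrA -mulrA [eta ^+ 2 * _]mulrA eVV; field.
have dist D1 D2 : D1 <= Num.min (2 ^+ 16 * m1 ^+ 2) A -> D2 <= Num.min (2 ^+ 16 * m2 ^+ 2) A ->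
    forall z : 'I_(d + d) -> int,
    D1 + D2 <= \sum_j (dilate (m1 * eta) (m2 * eta) j - (z j)%:~R) ^+ 2.
  move=> H1 H2 z; rewrite big_split_ord /=; apply: lerD.
    under eq_bigr do rewrite dilate_l.
    by apply: le_trans H1 _; rewrite -eV; exact: far.
  under eq_bigr do rewrite dilate_r.
  by apply: le_trans H2 _; rewrite -eV; exact: far.
have p0 m : 0 <= 2 ^+ 16 * m ^+ 2 :> R by rewrite mulr_ge0 ?sqr_ge0 ?exprn_ge0.
have e0 := @expR_ge0 R.
have [a1|/ltW a1] := leP (2 ^+ 16 * m1 ^+ 2) A; last first.
  apply: (@le_trans _ _ (expR (hs2 B * 3 / 8 - A / 32))); last by rewrite lerDr !mulr_ge0.
  apply: smoothed_far => // z; rewrite -[leLHS]addr0.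
  by apply: dist; rewrite le_min ?p0 ?a1 ?lexx.
have [a2|/ltW a2] := leP (2 ^+ 16 * m2 ^+ 2) A; last first.
  apply: (@le_trans _ _ (expR (hs2 B * 3 / 8 - A / 32))); last by rewrite lerDr !mulr_ge0.
  apply: smoothed_far => // z; rewrite -[leLHS]add0r.
  by apply: dist; rewrite le_min ?p0 ?a2 ?lexx.
rewrite -expRD; apply: ler_wpDr; first exact: e0.
have -> : - m1 ^+ 2 - m2 ^+ 2 = - (2 ^- 16 * (2 ^+ 16 * m1 ^+ 2 + 2 ^+ 16 * m2 ^+ 2)) :> R.
  by field.
apply: smoothed_interp => //; first by rewrite addr_ge0.
by apply: dist; rewrite le_min ?a1 ?a2 ?lexx.
Qed.

(** The product of cosines is half the sum of the characters at [(m1, m2)] and [(m1, - m2)], and the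
    bound is even in [m2]. *)
Lemma esp_cos_cos (a1 a2 m1 m2 : R) : `|m1 * eta| <= 16 -> `|m2 * eta| <= 16 ->
  esp (fun x => cos (a1 + 2 * pi * (m1 * eta * ldot x)) *
                cos (a2 + 2 * pi * (m2 * eta * rdot x)) * weight B x) <=
  expR (- (hs2 B / 3520)) * (expR (- m1 ^+ 2) * expR (- m2 ^+ 2))
  + expR (hs2 B * 3 / 8 - A / 32).
Proof.
move=> h1 h2; set rhs := _ + _.
pose f s x := cos (a1 + s * a2 + 2 * pi * \sum_j dilate (m1 * eta) (s * m2 * eta) j * x j) * weight B x.
have hf s : s ^+ 2 = 1 -> `|s| = 1 -> esp (f s) <= rhs.
  move=> s2 s1; rewrite /f esp_char_weight.
  apply: (@le_trans _ _ (smoothed B (dilate (m1 * eta) (s * m2 * eta)))).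
    by rewrite ler_piMl ?cos_le1 ?smoothed_ge0.
  apply: le_trans (smoothed_dilate h1 _) _; first by rewrite -mulrA normrM s1 mul1r.
  by rewrite exprMn s2 mul1r.
have -> : esp (fun x => cos (a1 + 2 * pi * (m1 * eta * ldot x)) *
                cos (a2 + 2 * pi * (m2 * eta * rdot x)) * weight B x) =
    1 / 2 * esp (f 1) + 1 / 2 * esp (f (-1)).
  rewrite -!espZ -espD; apply: eq_esp => x; rewrite /f !dilate_dot.
  set p := a1 + 2 * pi * _; set q := a2 + 2 * pi * _.
  rewrite (_ : a1 + 1 * a2 + _ = p + q); last by rewrite /p /q; ring.
  rewrite (_ : a1 + -1 * a2 + _ = p - q); last by rewrite /p /q; ring.
  by rewrite cosD cosB; field.
have := hf 1 (expr1n _ _) (normr1 _).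
have := hf (-1); rewrite sqrrN normrN expr1n normr1 => /(_ erefl erefl).
lra.
Qed.

(** The main term gains [12 / L] once for each half of the row. The capped term is not averaged and
    only meets the total mass [4^2] of the coefficients. *)
Lemma esp_row :
  esp (fun x => kernel L C eta (ldot x) * kernel L C eta (rdot x) * weight B x) <=
  expR (- (hs2 B / 3520)) * (12 / L%:R) ^+ 2 + 16 * expR (hs2 B * 3 / 8 - A / 32).
Proof.
pose ph (q : kindex L C) : R := - (2 * pi * (kfreq R q * eta * phase R q.1)).
pose F (p q : kindex L C) x := cos (ph p + 2 * pi * (kfreq R p * eta * ldot x)) *
                cos (ph q + 2 * pi * (kfreq R q * eta * rdot x)) * weight B x.
have kk x : kernel L C eta (ldot x) * kernel L C eta (rdot x) * weight B x =
    \sum_p \sum_q kcoef R p * kcoef R q * F p q x.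
  rewrite !kernelE // !mulr_suml; apply: eq_bigr => p _.
  by rewrite mulr_sumr mulr_suml; apply: eq_bigr => q _; rewrite /F /ph; ring.
rewrite (eq_esp kk) esp_sum.
set K := expR (- (hs2 B / 3520)); set E := expR (_ - _).
have c0 p : 0 <= kcoef R p :> R.
  by rewrite /kcoef mulr_ge0 ?half_exp_ge0 // invr_ge0 exprn_ge0.
have fr (p : kindex L C) : `|kfreq R p * eta| <= 16.
  apply: le_trans etaL; rewrite normrM ler_wpM2r // /kfreq.
  have hl (c : 'I_L) : 0 <= c%:R :> R /\ c%:R <= L%:R - 1 :> R.
    by split; [exact: ler0n | rewrite lerBrDr natr1 ler_nat].
  have [a0 a1] := hl p.2.1; have [b0 b1] := hl p.2.2.
  by rewrite ler_norml; apply/andP; split; lra.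
pose g (p : kindex L C) := expR (- kfreq R p ^+ 2).
apply: (@le_trans _ _ (\sum_p \sum_q kcoef R p * kcoef R q * (K * (g p * g q) + E))).
  apply: ler_sum => p _; rewrite esp_sum; apply: ler_sum => q _.
  rewrite espZ; apply: ler_wpM2l; first by rewrite mulr_ge0.
  exact: esp_cos_cos.
have -> : \sum_p \sum_q kcoef R p * kcoef R q * (K * (g p * g q) + E) =
    K * (\sum_p kcoef R p * g p) ^+ 2 + E * (\sum_(p : kindex L C) kcoef R p) ^+ 2.
  transitivity (\sum_p (K * (kcoef R p * g p) * (\sum_p kcoef R p * g p) +
                        E * kcoef R p * \sum_(p : kindex L C) kcoef R p)).
    apply: eq_bigr => p _; rewrite !mulr_sumr -big_split.
    by apply: eq_bigr => q _ /=; ring.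
  by rewrite big_split /=; congr (_ + _); rewrite -[LHS]mulr_suml -mulr_sumr expr2 mulrA.
have K0 : 0 <= K := expR_ge0 _; have E0 : 0 <= E := expR_ge0 _.
have s1 := sum_kcoef R C L0; have s2 := sum_kcoef_gauss R C L0.
have s10 : 0 <= \sum_(p : kindex L C) kcoef R p by apply: sumr_ge0.
have s20 : 0 <= \sum_p kcoef R p * g p by apply: sumr_ge0 => p _; rewrite mulr_ge0 ?expR_ge0.
apply: lerD; first by rewrite ler_wpM2l // lerXn2r ?nnegrE ?divr_ge0 ?ler0n.
rewrite mulrC ler_wpM2r //; nra.
Qed.

End Row.

(** ** Tensorization over the rows *)

Section RandomMatrix.
Variables (R : realType) (p q : nat).
Implicit Types (H : 'M[R]_(p, q)) (E : 'M[R]_(p, q) -> bool).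

Lemma probH_tensor E (f : ('I_q -> R) -> R) (c : R) :
  0 <= c -> (forall x, 0 <= f x) ->
  (forall H, (forall i j, `|H i j| <= 1) -> E H -> 1 <= c * \prod_i f (H i)) ->
  probH E <= c * esp f ^+ p.
Proof.
move=> c0 f0 hE.
pose W (M : 'M['I_3]_(p, q)) := \prod_i \prod_j entry_weight R (M i j).
pose mx (M : 'M['I_3]_(p, q)) : 'M[R]_(p, q) := map_mx (entry_val R) M.
have W0 M : 0 <= W M.
  by apply: prodr_ge0 => i _; apply: prodr_ge0 => j _; exact/ltW/entry_weight_gt0.
have P0 (H : 'M[R]_(p, q)) : 0 <= c * \prod_i f (H i) by rewrite mulr_ge0 // prodr_ge0.
apply: (@le_trans _ _ (\sum_M W M * (c * \prod_i f (mx M i)))).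
  rewrite /probH big_mkcond; apply: ler_sum => M _.
  case: ifP => [EM|_]; last by rewrite mulr_ge0.
  rewrite -[leLHS]mulr1 ler_wpM2l ?W0 //.
  by apply: hE => // i j; rewrite mxE norm_entry_val.
have -> : \sum_(M : 'M['I_3]_(p, q)) W M * (c * \prod_i f (mx M i)) = c * \sum_(M : 'M['I_3]_(p, q)) \prod_i
    ((\prod_j entry_weight R (M i j)) * f (mx M i)).
  by rewrite mulr_sumr; apply: eq_bigr => M _; rewrite big_split /= mulrCA.
rewrite ler_wpM2l // -[p in leRHS]card_ord -prodr_const /esp.
rewrite (bigA_distr_bigA (fun (i : 'I_p) (s : {ffun 'I_q -> 'I_3}) =>
  (\prod_j entry_weight R (s j)) * f (fun j => entry_val R (s j)))).
pose tomx (g : {ffun 'I_p -> {ffun 'I_q -> 'I_3}}) : 'M['I_3]_(p, q) := \matrix_(i, j) g i j.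
pose ofmx (M : 'M['I_3]_(p, q)) : {ffun 'I_p -> {ffun 'I_q -> 'I_3}} := [ffun i => [ffun j => M i j]].
rewrite (reindex tomx) /=; last first.
  exists ofmx => [g _|M _].
    by apply/ffunP => i; apply/ffunP => j; rewrite !ffunE mxE.
  by apply/matrixP => i j; rewrite mxE !ffunE.
rewrite le_eqVlt; apply/orP; left; apply/eqP; apply: eq_bigr => g _; apply: eq_bigr => i _.
congr (_ * f _); first by apply: eq_bigr => j _; rewrite mxE.
by apply/funext => j; rewrite !mxE.
Qed.

Lemma probH_union (Z : finType) (P : pred Z) E (F : Z -> 'M[R]_(p, q) -> bool) :
  (forall H, (forall i j, `|H i j| <= 1) -> E H -> exists2 z, P z & F z H) ->
  probH E <= \sum_(z | P z) probH (F z).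
Proof.
move=> hE; rewrite /probH big_mkcond /=.
under [leRHS]eq_bigr do rewrite big_mkcond.
rewrite exchange_big /=; apply: ler_sum => M _.
have W0 : 0 <= \prod_i \prod_j entry_weight R (M i j).
  by apply: prodr_ge0 => i _; apply: prodr_ge0 => j _; exact/ltW/entry_weight_gt0.
have S0 (Q : pred Z) : 0 <= \sum_(z | Q z) if F z (map_mx (entry_val R) M)
     then \prod_i \prod_j entry_weight R (M i j) else 0.
  by apply: sumr_ge0 => z _; case: ifP.
case: ifP => [/hE[i j|z Pz Fz]|_]; [by rewrite mxE norm_entry_val| |exact: S0].
by rewrite (bigD1 z) //= Fz lerDl S0.
Qed.

End RandomMatrix.

(** ** Frames and resolvents *)

Section HilbertSchmidt.
Variable R : realType.

Definition hs m n (A : 'M[R]_(m, n)) : R := \sum_i \sum_j A i j ^+ 2.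

Lemma hsE m n (A : 'M[R]_(m, n)) : hs A = \tr (A^T *m A).
Proof.
rewrite /hs exchange_big /mxtrace; apply: eq_bigr => j _ /=.
by rewrite mxE; apply: eq_bigr => i _; rewrite mxE expr2.
Qed.

Lemma hs_ge0 m n (A : 'M[R]_(m, n)) : 0 <= hs A.
Proof. by apply: sumr_ge0 => i _; apply: sumr_ge0 => j _; exact: sqr_ge0. Qed.

Lemma hs_eq0 m n (A : 'M[R]_(m, n)) : hs A = 0 -> A = 0.
Proof.
move=> /eqP; rewrite psumr_eq0 => [/allP h|i _]; last by apply: sumr_ge0 => j _; exact: sqr_ge0.
apply/matrixP => i j; have := h i (mem_index_enum _).
rewrite psumr_eq0 => [/allP/(_ j (mem_index_enum _))|k _]; last exact: sqr_ge0.
by rewrite sqrf_eq0 mxE => /eqP.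
Qed.

Lemma hs_tr m n (A : 'M[R]_(m, n)) : hs A^T = hs A.
Proof. by rewrite !hsE trmxK mxtrace_mulC. Qed.

Lemma hsD m n (A B : 'M[R]_(m, n)) : hs (A + B) = hs A + 2 * \tr (A^T *m B) + hs B.
Proof.
rewrite !hsE [(A + B)^T]linearD /= mulmxDl !mulmxDr !mxtraceD.
have -> : \tr (B^T *m A) = \tr (A^T *m B) by rewrite -mxtrace_tr trmx_mul trmxK.
by ring.
Qed.

Lemma hsZ m n c (A : 'M[R]_(m, n)) : hs (c *: A) = c ^+ 2 * hs A.
Proof. by rewrite !hsE [(c *: A)^T]linearZ /= -scalemxAl -scalemxAr !mxtraceZ; ring. Qed.

Lemma hs_row_mx m n1 n2 (A : 'M[R]_(m, n1)) (B : 'M_(m, n2)) :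
  hs (row_mx A B) = hs A + hs B.
Proof.
rewrite /hs -big_split; apply: eq_bigr => i _ /=; rewrite big_split_ord /=.
by congr (_ + _); apply: eq_bigr => j _; rewrite (row_mxEl, row_mxEr).
Qed.

Lemma hs_col m n (A : 'M[R]_(m, n)) : hs A = \sum_j hs (col j A).
Proof.
rewrite /hs exchange_big; apply: eq_bigr => j _ /=.
by apply: eq_bigr => i _; rewrite big_ord1 mxE.
Qed.

(** A substitute for orthonormal columns: the real and imaginary parts of complex eigenvectors form
    a Bessel system but need not be orthogonal. *)
Definition bessel q p (U : 'M[R]_(q, p)) := forall x : 'cV[R]_q, hs (U^T *m x) <= hs x.

Lemma bessel_mx q p m (U : 'M[R]_(q, p)) (V : 'M[R]_(q, m)) :
  bessel U -> hs (U^T *m V) <= hs V.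
Proof.
move=> bU; rewrite (hs_col (_ *m _)) (hs_col V); apply: ler_sum => j _.
by rewrite colE -mulmxA -colE; exact: bU.
Qed.

(* The quadratic form [V V^T] of an approximate frame need not be a
   contraction; its resolvent [V V^T (1 + V V^T)^-1] is one, is still dominated
   by [V V^T], and keeps a constant fraction of the trace. It is written below
   as [B B^T] with [B := row_mx (C V) (C A)]. *)
Section Resolvent.
Variables (q p : nat) (V : 'M[R]_(q, p)).

Let A := V *m V^T.
Let S := 1%:M + A.
Let C := invmx S.

Let trA : A^T = A. Proof. by rewrite /A trmx_mul trmxK. Qed.
Let trS : S^T = S. Proof. by rewrite /S [(_ + _)^T]linearD /= trmx1 trA. Qed.

Let unitS : S \in unitmx.
Proof.
rewrite -row_free_unit; apply: inj_row_free => v vS.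
apply: hs_eq0; apply/eqP; rewrite eq_le hs_ge0 andbT.
have : \tr (v *m S *m v^T) = hs v + hs (v *m V).
  rewrite /S mulmxDr mulmx1 mulmxDl mxtraceD -(hs_tr v) -(hs_tr (v *m V)) !hsE.
  by rewrite !trmxK trmx_mul /A !mulmxA.
rewrite vS mul0mx mxtrace0; have := hs_ge0 (v *m V); lra.
Qed.

Let trC : C^T = C. Proof. by rewrite /C trmx_inv trS. Qed.
Let CS : C *m S = 1%:M. Proof. by rewrite mulVmx. Qed.
Let SC : S *m C = 1%:M. Proof. by rewrite mulmxV. Qed.

Definition resolvent_root : 'M[R]_(q, p + q) := row_mx (C *m V) (C *m A).

Let rrT m (x : 'M[R]_(q, m)) : hs (resolvent_root^T *m x) =
  hs (V^T *m (C *m x)) + hs (A *m (C *m x)).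
Proof.
rewrite -hs_tr trmx_mul trmxK /resolvent_root mul_mx_row hs_row_mx.
congr (_ + _); rewrite -hs_tr trmx_mul trmxK.
  by rewrite [(C *m V)^T]trmx_mul trC !mulmxA.
by rewrite [(C *m A)^T]trmx_mul trC trA !mulmxA.
Qed.

(** With [y = C x], so that [x = y + A y], both resolvent inequalities become comparisons of sums of
    the squares [|y|^2], [|V^T y|^2], [|A y|^2] and [|V^T A y|^2]. *)
Let xE m (x : 'M[R]_(q, m)) : x = C *m x + A *m (C *m x).
Proof. by rewrite -[X in X + _]mul1mx -mulmxDl mulmxA SC mul1mx. Qed.

Let tr_A m (x y : 'M[R]_(q, m)) : \tr (x^T *m (A *m y)) = \tr ((V^T *m x)^T *m (V^T *m y)).
Proof. by rewrite trmx_mul trmxK /A !mulmxA. Qed.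

Lemma resolvent_contr (x : 'cV[R]_q) : hs (resolvent_root^T *m x) <= hs x.
Proof.
rewrite rrT [in leRHS](xE x) hsD tr_A -hsE.
have := hs_ge0 (C *m x); have := hs_ge0 (V^T *m (C *m x)); lra.
Qed.

Lemma resolvent_le (x : 'cV[R]_q) : hs (resolvent_root^T *m x) <= hs (V^T *m x).
Proof.
rewrite rrT [in leRHS](xE x) mulmxDr hsD -tr_A.
have -> : \tr ((C *m x)^T *m (A *m (A *m (C *m x)))) = hs (A *m (C *m x)).
  by rewrite hsE [(A *m (C *m x))^T]trmx_mul trA !mulmxA.
have := hs_ge0 (A *m (C *m x)); have := hs_ge0 (V^T *m (A *m (C *m x))); lra.
Qed.

Let tr_S m (x : 'M[R]_(q, m)) : \tr (x^T *m (S *m x)) = hs x + hs (V^T *m x).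
Proof. by rewrite /S mulmxDl mul1mx mulmxDr mxtraceD tr_A -!hsE. Qed.

Lemma hs_resolventE : hs resolvent_root = \tr (C *m A).
Proof.
rewrite -hs_tr -[resolvent_root^T]mulmx1 rrT mulmx1 !hsE.
rewrite [(A *m C)^T]trmx_mul [(V^T *m C)^T]trmx_mul trmxK trA trC.
have -> : C *m V *m (V^T *m C) = C *m A *m C by rewrite /A !mulmxA.
have -> : C *m A *m (A *m C) = C *m A *m A *m C by rewrite !mulmxA.
rewrite -mxtraceD -mulmxDl -[X in X + _]mulmx1 -mulmxDr -[X in X *m C]mulmxA.
by rewrite -mulmxA -[A *m _ *m C]mulmxA SC mulmx1.
Qed.

Lemma hs_resolvent_le : hs resolvent_root <= hs V.
Proof.
have -> : hs V = \tr (C *m S *m A) by rewrite CS mul1mx hsE mxtrace_mulC.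
rewrite hs_resolventE /S mulmxDr mulmx1 mulmxDl mxtraceD lerDl.
have -> : \tr (C *m A *m A) = \tr ((C *m A)^T *m (S *m (C *m A))).
  by rewrite [S *m _]mulmxA SC mul1mx [(C *m A)^T]trmx_mul trC trA mxtrace_mulC mulmxA.
by rewrite tr_S addr_ge0 ?hs_ge0.
Qed.

(** A variational lower bound on [tr (V^T C V)]: the [S]-form is nonnegative at [C V - U / 4], which
    gives [tr (U^T V) / 2 - (|U|^2 + |V^T U|^2) / 16]. For [V = U] this is at least [3 k / 8]; the
    slack absorbs the perturbation. *)
Lemma hs_resolvent_ge (U : 'M[R]_(q, p)) k : bessel U -> hs U = k -> hs (V - U) <= k / 64 ->
  k / 8 <= hs resolvent_root.
Proof.
move=> bU hU hE; set E := V - U in hE.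
have VE : V = U + E by rewrite /E addrC subrK.
have tr0 : \tr (U^T *m V) = hs U + \tr (U^T *m E) by rewrite VE mulmxDr mxtraceD hsE.
have : 0 <= hs (U + 4%:R *: E) by exact: hs_ge0.
rewrite hsD hsZ -scalemxAr mxtraceZ => h1.
have : 0 <= hs (U - E) by exact: hs_ge0.
rewrite -[- E]scaleN1r hsD hsZ -scalemxAr mxtraceZ => h2.
have hV : hs V = hs U + 2 * \tr (U^T *m E) + hs E by rewrite VE hsD.
have hVU : hs (V^T *m U) <= hs V.
  by rewrite -hs_tr trmx_mul trmxK; exact: bessel_mx.
have : 0 <= \tr ((C *m V - (1 / 4) *: U)^T *m (S *m (C *m V - (1 / 4) *: U))).
  by rewrite tr_S addr_ge0 ?hs_ge0.
have -> : S *m (C *m V - (1 / 4) *: U) = V - (1 / 4) *: (S *m U).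
  by rewrite mulmxBr mulmxA SC mul1mx scalemxAr.
have -> : (C *m V - (1 / 4) *: U)^T = V^T *m C - (1 / 4) *: U^T.
  by rewrite [(_ - _)^T]linearB /= [(_ *: _)^T]linearZ /= trmx_mul trC.
have trB (X Y : 'M[R]_p) : \tr (X - Y) = \tr X - \tr Y by exact: raddfB.
rewrite mulmxBl !mulmxBr !trB -!scalemxAl -!scalemxAr !mxtraceZ tr_S.
have -> : \tr (V^T *m C *m V) = hs resolvent_root.
  by rewrite hs_resolventE mxtrace_mulC mulmxA mxtrace_mulC.
have -> : \tr (V^T *m C *m (S *m U)) = \tr (U^T *m V).
  rewrite mulmxA -[_ *m C *m S]mulmxA CS mulmx1.
  by rewrite -mxtrace_tr trmx_mul trmxK.
have := hs_ge0 E; lra.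
Qed.

End Resolvent.

(** Each column of the resolvent root is split into [M] copies divided by [sqrt M]. This preserves
    [qform] and [hs2] while making every single linear form small, as the Gaussian bound on [psi]
    requires. *)
Lemma frame_columns q p (U V : 'M[R]_(q, p)) k : bessel U -> hs U = k -> hs (V - U) <= k / 64 ->
  exists (I : finType) (B : 'I_q -> I -> R),
  [/\ forall x, qform B x <= \sum_j x j ^+ 2,
      forall x, (forall j, `|x j| <= 1) -> forall i, `|tmulv B x i| <= 1 / 2,
      forall x, qform B x <= hs (V^T *m \col_j x j),
      k / 8 <= hs2 B & hs2 B <= hs V].
Proof.
move=> bU hU hE; pose B0 := resolvent_root V.
pose Sb : R := \sum_j \sum_l `|B0 j l|.
pose M := (Num.truncn ((2 * Sb) ^+ 2)).+1.
have M0 : 0 < M%:R :> R by rewrite ltr0n.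
have sM : 0 < Num.sqrt M%:R :> R by rewrite sqrtr_gt0.
have sM2 : Num.sqrt M%:R ^+ 2 = M%:R :> R by rewrite sqr_sqrtr // ltW.
pose B (j : 'I_q) (i : 'I_(p + q) * 'I_M) : R := B0 j i.1 / Num.sqrt M%:R.
have tE x i : tmulv B x i = (\sum_j B0 j i.1 * x j) / Num.sqrt M%:R.
  by rewrite mulr_suml; apply: eq_bigr => j _; rewrite /B mulrAC.
have sumM (F : 'I_(p + q) -> R) :
    \sum_(i : 'I_(p + q) * 'I_M) (F i.1 / Num.sqrt M%:R) ^+ 2 = \sum_l F l ^+ 2.
  rewrite -(pair_bigA _ (fun l _ => (F l / Num.sqrt M%:R) ^+ 2)) /=.
  apply: eq_bigr => l _; rewrite sumr_const card_ord -[LHS]mulr_natr.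
  by rewrite expr_div_n sM2 mulfVK // gt_eqF.
have qE x : qform B x = hs (B0^T *m \col_j x j).
  transitivity (\sum_l (\sum_j B0 j l * x j) ^+ 2).
    by rewrite -sumM; apply: eq_bigr => i _; rewrite tE.
  rewrite /hs; apply: eq_bigr => l _; rewrite big_ord1 mxE; congr (_ ^+ 2).
  by apply: eq_bigr => j _; rewrite !mxE.
have h2E : hs2 B = hs B0 by apply: eq_bigr => j _; exact: sumM.
exists ('I_(p + q) * 'I_M)%type, B; split.
- move=> x; rewrite qE; apply: le_trans (resolvent_contr _ _) _.
  by rewrite /hs; apply: ler_sum => j _; rewrite big_ord1 mxE.
- move=> x x1 i; rewrite tE normrM [`|_^-1|]ger0_norm ?invr_ge0 ?(ltW sM) //.
  rewrite ler_pdivrMr //; apply: (@le_trans _ _ Sb).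
    apply: le_trans (ler_norm_sum _ _ _) _; apply: ler_sum => j _.
    apply: (@le_trans _ _ `|B0 j i.1|); first by rewrite normrM ler_piMr.
    by rewrite (bigD1 i.1) //= lerDl sumr_ge0.
  have Sb0 : 0 <= Sb by apply: sumr_ge0 => j _; apply: sumr_ge0.
  have : 2 * Sb <= Num.sqrt M%:R.
    rewrite -(ger0_norm (_ : 0 <= 2 * Sb)) ?mulr_ge0 // -sqrtr_sqr ler_wsqrtr //.
    exact/ltW/truncnS_gt.
  lra.
- by move=> x; rewrite qE; exact: resolvent_le.
- by rewrite h2E; exact: hs_resolvent_ge bU hU hE.
- by rewrite h2E; exact: hs_resolvent_le.
Qed.

End HilbertSchmidt.

(** ** Real eigenvectors and singular values *)

Section RealSpectral.
Local Open Scope sesquilinear_scope.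
Variables (R : realType).
Let toC : {rmorphism R -> R[i]} := real_complex R.

Lemma Re_sum (I : Type) (r : seq I) (F : I -> R[i]) :
  complex.Re (\sum_(i <- r) F i) = \sum_(i <- r) complex.Re (F i).
Proof. by apply: (big_morph (@complex.Re R)) => // -[a b] [c e]. Qed.

Lemma Im_sum (I : Type) (r : seq I) (F : I -> R[i]) :
  complex.Im (\sum_(i <- r) F i) = \sum_(i <- r) complex.Im (F i).
Proof. by apply: (big_morph (@complex.Im R)) => // -[a b] [c e]. Qed.

Lemma ReM (z : R[i]) (a : R) : complex.Re (z * toC a) = complex.Re z * a.
Proof. by case: z => x y /=; rewrite mulr0 subr0. Qed.

Lemma ImM (z : R[i]) (a : R) : complex.Im (z * toC a) = complex.Im z * a.
Proof. by case: z => x y /=; rewrite mulr0 add0r. Qed.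

Lemma conjM (z w : R[i]) : complex.Re (z^* * w) =
  complex.Re z * complex.Re w + complex.Im z * complex.Im w.
Proof. by case: z w => [a b] [c e] /=; rewrite mulNr opprK. Qed.

(* The real and imaginary parts [P], [Q] of a unitary eigenvector matrix form
   a Parseval frame of real eigenvectors. *)
Lemma real_spectral n (A : 'M[R]_n) : A^T = A ->
  exists (l : 'rV[R]_n) (P Q : 'M[R]_n),
  [/\ P *m A = diag_mx l *m P, Q *m A = diag_mx l *m Q,
      P^T *m P + Q^T *m Q = 1%:M,
      forall i, \sum_j (P i j ^+ 2 + Q i j ^+ 2) = 1
    & char_poly A = \prod_(i < n) ('X - (l 0 i)%:P)].
Proof.
move=> symA; pose Ac : 'M[R[i]]_n := map_mx toC A.
have hA : Ac \is hermsymmx.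
  apply: realsym_hermsym.
    apply/is_hermitianmxP/matrixP => i j.
    by rewrite expr0 scale1r !mxE /= -{1}symA mxE.
  apply/mxOverP => i j; rewrite mxE; apply/complex_realP; by exists (A i j).
have nA := hermitian_normalmx hA.
have := orthomx_spectralP nA => /=.
have := hermitian_spectral_diag_real hA.
have := spectral_unitarymx Ac.
have := spectral_unit Ac.
set W := spectralmx Ac; set D := spectral_diag Ac => uW unW rD AE.
pose l : 'rV[R]_n := map_mx (@complex.Re R) D.
have lD : map_mx toC l = D.
  apply/rowP => i; rewrite !mxE; exact/RRe_real/(mxOverP rD).
have DE i : D 0 i = toC (l 0 i) by rewrite -lD mxE.
have WA : W *m Ac = diag_mx D *m W by rewrite {1}AE !mulmxA mulmxV // mul1mx.
have WW : W^t* *m W = 1%:M by rewrite -invmx_unitary // mulVmx.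
have WW' : W *m W^t* = 1%:M by exact/unitarymxP.
exists l, (map_mx (@complex.Re R) W), (map_mx (@complex.Im R) W); split.
- apply/matrixP => i j; have /matrixP/(_ i j)/(congr1 (@complex.Re R)) := WA.
  rewrite !mul_diag_mx [X in _ = complex.Re X]mxE [X in complex.Re X = _]mxE Re_sum.
  rewrite DE mulrC ReM => e; rewrite [RHS]mxE [LHS]mxE [X in _ = _ * X]mxE mulrC -e.
  by apply: eq_bigr => m _; rewrite !mxE ReM.
- apply/matrixP => i j; have /matrixP/(_ i j)/(congr1 (@complex.Im R)) := WA.
  rewrite !mul_diag_mx [X in _ = complex.Im X]mxE [X in complex.Im X = _]mxE Im_sum.
  rewrite DE mulrC ImM => e; rewrite [RHS]mxE [LHS]mxE [X in _ = _ * X]mxE mulrC -e.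
  by apply: eq_bigr => m _; rewrite !mxE ImM.
- apply/matrixP => i j; have /matrixP/(_ i j)/(congr1 (@complex.Re R)) := WW.
  rewrite !mxE Re_sum -big_split /= => e.
  transitivity (complex.Re ((i == j)%:R : R[i])); last by case: eqP.
  by rewrite -e; apply: eq_bigr => m _; rewrite !mxE conjM.
- move=> i; have /matrixP/(_ i i)/(congr1 (@complex.Re R)) := WW'.
  rewrite !mxE Re_sum eqxx /= => <-; apply: eq_bigr => m _.
  by rewrite !mxE mulrC conjM !expr2.
have e : map_mx polyC W *m char_poly_mx Ac = char_poly_mx (diag_mx D) *m map_mx polyC W.
  rewrite /char_poly_mx mulmxBr mulmxBl -!map_mxM WA.
  by rewrite scalar_mxC.
have := congr1 determinant e; rewrite !det_mulmx det_map_mx mulrC => /mulIf.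
rewrite polyC_eq0 -unitfE -unitmxE => /(_ uW) e'.
apply: (map_poly_inj toC); rewrite map_char_poly -/Ac [LHS]e' rmorph_prod /=.
rewrite -/(char_poly _) char_poly_trig; last exact: diag_mx_is_trig.
by apply: eq_bigr => i _; rewrite -lD map_polyXsubC !mxE eqxx.
Qed.

Lemma sorted_eigsP n (A : 'M[R]_n) : A^T = A -> sorted_eigs A (eigs_of A).
Proof.
move=> /real_spectral[l [_ [_ [_ _ _ _ cA]]]]; apply: epsilon_spec.
exists (sort (fun x y => y <= x) [seq l 0 i | i <- enum 'I_n]); split.
  by apply: sort_sorted => x y; exact: le_total.
split; first by rewrite size_sort size_map size_enum_ord.
by rewrite cA (perm_big _ (permEl (perm_sort _ _))) big_map big_enum.
Qed.

Lemma sum_inj_le (I J : finType) (g : I -> J) (F : J -> R) :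
  injective g -> (forall j, 0 <= F j) -> \sum_i F (g i) <= \sum_j F j.
Proof.
move=> gI F0; rewrite -(big_imset F (in2W gI)) /= big_mkcond /=.
by apply: ler_sum => j _; case: ifP.
Qed.

(** Take the real and imaginary parts of [k] eigenvectors of [H^T H] with eigenvalue at most [s^2].
    Each pair has total squared norm 1, whence [hs U = k] although there are [k + k] columns; the
    Bessel property is inherited from the Parseval frame. *)
Lemma small_sing_frame p q (H : 'M[R]_(p, q)) (k : nat) (s : R) :
  (k <= q)%N -> 0 <= s -> ((0 < k)%N -> sing_val H (q - k + 1) <= s) ->
  exists U : 'M[R]_(q, k + k),
    [/\ bessel U, hs U = k%:R & hs (H *m U) <= s ^+ 2 * k%:R].
Proof.
move=> kq s0 Hs; set A := H^T *m H.
have symA : A^T = A by rewrite /A trmx_mul trmxK.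
have [l [P [Q [PA QA PQ PQ1 cA]]]] := real_spectral symA.
have [es_sorted [es_size es_prod]] := sorted_eigsP symA.
set es := eigs_of A in es_sorted es_size es_prod.
have pl : perm_eq es [seq l 0 i | i <- enum 'I_q].
  by apply: prod_XsubC_eq; rewrite -es_prod cA big_map big_enum.
pose S := [set i | l 0 i <= s ^+ 2].
have kS : (k <= #|S|)%N.
  have [->//|k0] := posnP k.
  have mu : nth 0 es (q - k) <= s ^+ 2.
    have := Hs k0; rewrite /sing_val -/A -/es addn1 /= => h.
    (* [Num.sqrt] gives no information about a negative argument, but such an eigenvalue is below
       [s^2] anyway. *)
    have [n0|/ltW n0] := leP 0 (nth 0 es (q - k)).
      by rewrite -(sqr_sqrtr n0) lerXn2r ?nnegrE ?sqrtr_ge0.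
    by apply: le_trans n0 _; exact: sqr_ge0.
  have sk : size (drop (q - k) es) = k by rewrite size_drop es_size subKn.
  have -> : #|S| = count (fun x => x <= s ^+ 2) es.
    rewrite (permP pl) count_map cardE -size_filter /enum_mem -filter_predI.
    by congr size; apply: eq_filter => i; rewrite !inE andbT.
  rewrite -(cat_take_drop (q - k) es) count_cat.
  apply: leq_trans (leq_addl _ _); rewrite -[X in (X <= _)%N]sk.
  suff : all (fun x => x <= s ^+ 2) (drop (q - k) es) by rewrite all_count => /eqP->.
  apply/(all_nthP 0) => i; rewrite size_drop es_size (subKn kq) => ik.
  rewrite nth_drop; apply: le_trans mu.
  apply: (sorted_leq_nth (leT := fun x y : R => y <= x)) => //.
  - by move=> x y z /= xy yz; exact: le_trans yz xy.
  - by rewrite inE es_size ltn_subrL k0 (leq_trans k0).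
  - by rewrite inE es_size -ltn_subRL subKn.
  - exact: leq_addr.
pose g (i : 'I_k) : 'I_q := enum_val (widen_ord kS i).
have gI : injective g by move=> i j /enum_val_inj/(congr1 val)/= /val_inj.
have gS i : l 0 (g i) <= s ^+ 2 by have := enum_valP (widen_ord kS i); rewrite inE.
pose sub (X : 'M[R]_q) : 'M[R]_(k, q) := rowsub g X.
have HX (X : 'M[R]_q) : X *m A = diag_mx l *m X ->
    hs (H *m (sub X)^T) <= s ^+ 2 * hs (sub X).
  move=> XA; rewrite hsE trmx_mul trmxK mulmxA -[_ *m H]mulmxA -/A.
  rewrite /sub mul_rowsub_mx XA /mxtrace /hs mulr_sumr; apply: ler_sum => i _.
  rewrite mxE mulr_sumr; apply: ler_sum => j _.
  rewrite !mxE (bigD1 (g i)) //= big1 => [|m mi]; last first.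
    by rewrite mxE eq_sym (negPf mi) mulr0n mul0r.
  rewrite mxE eqxx mulr1n addr0 -mulrA -expr2.
  by rewrite ler_wpM2r ?sqr_ge0.
have hsU : hs (sub P) + hs (sub Q) = k%:R.
  rewrite /hs -big_split /=.
  rewrite -[RHS]mulr1 mulr_natl -[k in RHS]card_ord -sumr_const; apply: eq_bigr => i _.
  by rewrite -big_split -(PQ1 (g i)); apply: eq_bigr => j _; rewrite !mxE.
exists (row_mx (sub P)^T (sub Q)^T); split.
- move=> x; rewrite tr_row_mx !trmxK mul_col_mx.
  have -> : hs (col_mx (sub P *m x) (sub Q *m x)) = hs (sub P *m x) + hs (sub Q *m x).
    by rewrite -hs_tr tr_col_mx hs_row_mx !hs_tr.
  have hX (X : 'M[R]_q) : hs (sub X *m x) <= hs (X *m x).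
    rewrite /hs (eq_bigr (fun i => \sum_j (X *m x) (g i) j ^+ 2)).
      apply: (sum_inj_le gI (F := fun i => \sum_j (X *m x) i j ^+ 2)) => i.
      by apply: sumr_ge0 => j _; exact: sqr_ge0.
    by move=> i _; apply: eq_bigr => j _; rewrite mul_rowsub_mx mxE.
  apply: le_trans (lerD (hX P) (hX Q)) _.
  rewrite !hsE !trmx_mul -!mulmxA -mxtraceD -mulmxDr !mulmxA -mulmxDl PQ mul1mx.
  by [].
- by rewrite hs_row_mx !hs_tr.
- rewrite mul_mx_row hs_row_mx; apply: le_trans (lerD (HX P PA) (HX Q QA)) _.
  rewrite -mulrDr ler_wpM2l ?sqr_ge0 // le_eqVlt; apply/orP; left; apply/eqP.
  exact: hsU.
Qed.

End RealSpectral.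

(** ** Rounding to a grid *)

Section Rounding.
Variables (R : realType) (eps : R).
Hypothesis eps0 : 0 < eps.

(* Each coordinate is rounded up or down so that its contribution to [H e] does
   not correlate positively with what has accumulated so far. *)
Lemma round_coords p q (H : 'M[R]_(p, q)) (u : 'I_q -> R) (r : seq 'I_q) : uniq r ->
  exists e : 'cV[R]_q,
  [/\ forall j, j \notin r -> e j 0 = 0,
      forall j, j \in r -> `|e j 0| <= eps /\ exists z : int, e j 0 = eps * z%:~R - u j
    & hs (H *m e) <= eps ^+ 2 * \sum_(j <- r) hs (col j H)].
Proof.
elim: r => [_|j r IH /= /andP[jr ur]].
  exists 0; split => [j _|j|]; rewrite ?mxE ?in_nil //.
  by rewrite mulmx0 big_nil mulr0 /hs big1 // => i _; rewrite big1 // => k _; rewrite mxE expr0n.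
have [e [e_out e_in e_hs]] := IH ur.
pose t0 := eps * (Num.floor (u j / eps))%:~R - u j.
have t01 : - eps <= t0 <= 0.
  have /andP[f1 f2] : (Num.floor (u j / eps))%:~R <= u j / eps < (Num.floor (u j / eps) + 1)%:~R.
    by rewrite floor_le_tmp ?floorD1_gt.
  rewrite ler_pdivlMr // in f1; rewrite ltr_pdivrMr // intrD in f2.
  by rewrite /t0; apply/andP; split; lra.
pose c := \tr ((H *m e)^T *m col j H).
have [t [t1 [z tz] tc]] : exists t, [/\ `|t| <= eps,
    exists z : int, t = eps * z%:~R - u j & t * c <= 0].
  have /andP[t0a t0b] := t01.
  have [c0|/ltW c0] := leP 0 c.
    exists t0; split; [by rewrite ler_norml t0a; lra|by eexists|exact: mulr_le0_ge0].
  exists (t0 + eps); split; last by rewrite mulr_ge0_le0 //; lra.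
    by rewrite ler_norml; apply/andP; split; lra.
  by exists (Num.floor (u j / eps) + 1); rewrite intrD /t0; ring.
exists (e + t *: delta_mx j 0); split.
- move=> i; rewrite in_cons negb_or => /andP[ij ir].
  by rewrite !mxE (negPf ij) andFb mulr0 addr0 e_out.
- move=> i; rewrite in_cons !mxE; have [->|ij] := eqVneq i j => /= [_|ir].
    by rewrite ?eqxx /= mulr1 e_out // add0r; split=> //; exists z.
  by rewrite mulr0 addr0; exact: e_in.
rewrite mulmxDr -scalemxAr -colE hsD hsZ -scalemxAr mxtraceZ -/c big_cons mulrDr.
have : t ^+ 2 * hs (col j H) <= eps ^+ 2 * hs (col j H).
  rewrite ler_wpM2r ?hs_ge0 // -[t ^+ 2]real_normK ?num_real //.
  by rewrite lerXn2r ?nnegrE // ltW.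
lra.
Qed.

(** Only [hs H] enters, which is at most [2 d n] for every matrix with entries bounded by 1, so no
    event on the operator norm has to be excluded. Bounding [|H e|] by [|e|] times [sqrt (hs H)]
    would lose a factor [q] in the square. *)
Lemma round_mx p q m (H : 'M[R]_(p, q)) (U : 'M[R]_(q, m)) :
  exists Z : 'M[int]_(q, m), let E := eps *: map_mx intr Z - U in
  (forall i j, `|E i j| <= eps) /\ hs (H *m E) <= m%:R * eps ^+ 2 * hs H.
Proof.
have h (j : 'I_m) : exists z : 'cV[int]_q, let e := eps *: map_mx intr z - col j U in
    (forall i, `|e i 0| <= eps) /\ hs (H *m e) <= eps ^+ 2 * hs H.
  have [e [_ e_in e_hs]] := round_coords H (fun i => U i j) (enum_uniq 'I_q).
  have ez i : exists z : int, e i 0 = eps * z%:~R - U i j.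
    by have [] := e_in i (mem_enum _ _).
  exists (\col_i projT1 (cid (ez i))).
  have -> : eps *: map_mx intr (\col_i projT1 (cid (ez i))) - col j U = e.
    by apply/colP => i; rewrite !mxE; case: cid.
  split=> [i|]; first by have [] := e_in i (mem_enum _ _).
  by rewrite (hs_col H) -big_enum.
pose Z := \matrix_(i, j) projT1 (cid (h j)) i 0.
exists Z => E.
have cE j : col j E = eps *: map_mx intr (projT1 (cid (h j))) - col j U.
  by apply/colP => i; rewrite !mxE.
split=> [i j|].
  have -> : E i j = col j E i 0 by rewrite [RHS]mxE.
  by rewrite cE; case: cid => z /= [].
rewrite hs_col -mulrA mulr_natl -[m in leRHS]card_ord -sumr_const; apply: ler_sum => j _.
by rewrite colE -mulmxA -colE cE; case: cid => z /= [].
Qed.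

End Rounding.

Lemma sum_exp_abs_le (R : realType) (del : R) (L a : nat) : 0 < del -> del <= 1 / 2 ->
  \sum_(b < L) expR (- (del * `|b%:R - a%:R|)) <= 3 / del.
Proof.
move=> d0 d1; set x := expR (- del).
have x0 : 0 < x := expR_gt0 _.
have xd : (1 + del) * x <= 1.
  by rewrite /x expRN ler_pdivrMr ?expR_gt0 // mul1r expR_ge1Dx.
have x01 : 0 <= x <= 1 by rewrite ltW //= -[leRHS]expR0 ler_expR; lra.
have := sum_exp_dist L a x01.
have -> : \sum_(b < L) x ^+ ((a - b) + (b - a)) = \sum_(b < L) expR (- (del * `|b%:R - a%:R|)).
  apply: eq_bigr => b _; rewrite /x -expRM_natl mulrN mulrC; congr (expR (- (_ * _))).
  have [ab|/ltnW ba] := leqP a b.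
    by rewrite (eqP (ab : (a - b == 0)%N)) add0n natrB // ger0_norm // subr_ge0 ler_nat.
  by rewrite (eqP (ba : (b - a == 0)%N)) addn0 natrB // ler0_norm ?opprB // subr_le0 ler_nat.
set S := \sum_(b < L) _ => hS.
have S0 : 0 <= S by apply: sumr_ge0 => b _; exact: expR_ge0.
rewrite ler_pdivlMr //; nra.
Qed.

(** An exponential Markov bound for counting: each admissible point has
    [exp (del (W - l1 norm)) >= 1], and the sum over all points factorizes. The result does not
    depend on the range [b], so a crude range is harmless. *)
Lemma count_l1_ball (R : realType) (q m b : nat) (del W : R)
  (P : pred 'M['I_(b + b).+1]_(q, m)) : 0 < del -> del <= 1 / 2 ->
  (forall z, P z -> \sum_i \sum_j `|(z i j)%:R - b%:R : R| <= W) ->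
  #|P|%:R <= expR (del * W) * (3 / del) ^+ (q * m).
Proof.
move=> d0 d1 PW.
pose w (t : 'I_(b + b).+1) : R := expR (- (del * `|t%:R - b%:R|)).
apply: (@le_trans _ _ (expR (del * W) *
  \sum_(z : 'M['I_(b + b).+1]_(q, m)) \prod_(p : 'I_q * 'I_m) w (z p.1 p.2))).
  rewrite mulr_sumr -sum1_card natr_sum big_mkcond /=; apply: ler_sum => z _.
  have prodE : \prod_(p : 'I_q * 'I_m) w (z p.1 p.2) =
      expR (- (del * \sum_i \sum_j `|(z i j)%:R - b%:R : R|)).
    by rewrite pair_bigA mulr_sumr -sumrN expR_sum.
  rewrite prodE -expRD; case: ifP => [Pz|_]; last exact: expR_ge0.
  by rewrite -[leLHS]expR0 ler_expR; have := ler_wpM2l (ltW d0) (PW z Pz); lra.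
rewrite ler_wpM2l ?expR_ge0 //.
pose tomx (g : {ffun 'I_q * 'I_m -> 'I_(b + b).+1}) : 'M['I_(b + b).+1]_(q, m) :=
  \matrix_(i, j) g (i, j).
pose ofmx (M : 'M['I_(b + b).+1]_(q, m)) : {ffun 'I_q * 'I_m -> 'I_(b + b).+1} :=
  [ffun p => M p.1 p.2].
rewrite (reindex tomx) /=; last first.
  exists ofmx => [g _|M _].
    by apply/ffunP => -[i j]; rewrite !ffunE mxE.
  by apply/matrixP => i j; rewrite mxE !ffunE.
under eq_bigr do under eq_bigr do rewrite mxE -surjective_pairing.
rewrite -(bigA_distr_bigA (fun _ t => w t)) prodr_const card_prod !card_ord.
apply: lerXn2r; rewrite ?nnegrE.
- by apply: sumr_ge0 => t _; exact: expR_ge0.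
- by rewrite divr_ge0 // ltW.
- exact: sum_exp_abs_le.
Qed.

(** ** Proof of the theorem *)

Section Main.
Variable R : realType.

Lemma norm2_sqr m (x : 'cV[R]_m) : norm2 x ^+ 2 = \sum_i x i 0 ^+ 2.
Proof. by rewrite sqr_sqrtr // sumr_ge0 // => i _; exact: sqr_ge0. Qed.

Lemma norm2_ge0 m (x : 'cV[R]_m) : 0 <= norm2 x.
Proof. exact: sqrtr_ge0. Qed.

Lemma torus_norm_le m (x : 'cV[R]_m) (z : 'I_m -> int) :
  torus_norm x ^+ 2 <= \sum_i (x i 0 - (z i)%:~R) ^+ 2.
Proof.
pose zc : 'cV[int]_m := \col_i z i.
have -> : \sum_i (x i 0 - (z i)%:~R) ^+ 2 = norm2 (x - map_mx (fun t : int => t%:~R) zc) ^+ 2.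
  by rewrite norm2_sqr; apply: eq_bigr => i _; rewrite !mxE.
have lb : lbound [set r : R | exists z : 'cV[int]_m,
    r = norm2 (x - map_mx (fun t : int => t%:~R) z)] 0.
  by move=> _ [w ->]; exact: norm2_ge0.
have ne : ([set r : R | exists z : 'cV[int]_m,
    r = norm2 (x - map_mx (fun t : int => t%:~R) z)] !=set0)%classic.
  by exists (norm2 (x - map_mx (fun t : int => t%:~R) zc)), zc.
rewrite lerXn2r ?nnegrE ?norm2_ge0 //; first exact: lb_le_inf.
by apply: ge_inf; [exists 0 | exists zc].
Qed.

(** Otherwise some [s] in [(0, D]] would belong to the set whose infimum is [D_alpha]. Negative [t]
    follow by symmetry, and at 0 the left-hand side is not positive. *)
Lemma D_alpha_far d (alpha : R) (v : 'cV[R]_d) (D t : R) (z : 'I_d -> int) :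
  0 <= alpha -> D < D_alpha alpha v -> `|t| <= D ->
  Num.min (t ^+ 2 * (\sum_i v i 0 ^+ 2) / 4) (alpha * d%:R)
    <= \sum_i (t * v i 0 - (z i)%:~R) ^+ 2.
Proof.
move=> a0 DD.
have pos s (w : 'I_d -> int) : 0 < s <= D ->
    Num.min (s ^+ 2 * (\sum_i v i 0 ^+ 2) / 4) (alpha * d%:R)
      <= \sum_i (s * v i 0 - (w i)%:~R) ^+ 2.
  move=> /andP[s0 sD].
  have := torus_norm_le (s *: v) w.
  under eq_bigr do rewrite mxE; apply: le_trans.
  have : Num.min (s * norm2 v / 2) (Num.sqrt (alpha * d%:R)) <= torus_norm (s *: v).
    rewrite leNgt; apply/negP => /ltW h.
    move: DD; rewrite ltNge => /negP; apply; apply: le_trans sD.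
    by apply: ge_inf; [exists 0 => ? [/ltW] | split].
  have ad0 : 0 <= alpha * d%:R by rewrite mulr_ge0.
  have sv0 : 0 <= s * norm2 v / 2 by rewrite divr_ge0 // mulr_ge0 ?norm2_ge0 // ltW.
  have -> : s ^+ 2 * (\sum_i v i 0 ^+ 2) / 4 = (s * norm2 v / 2) ^+ 2.
    by rewrite -norm2_sqr; field.
  rewrite ge_min => /orP[h|h]; rewrite ge_min; apply/orP; [left|right].
    by rewrite lerXn2r ?nnegrE // (le_trans sv0).
  rewrite -[leLHS](sqr_sqrtr ad0) lerXn2r ?nnegrE ?sqrtr_ge0 //.
  by rewrite (le_trans _ h) ?sqrtr_ge0.
have [t0|t0|<-] := ltgtP 0 t.
- by rewrite gtr0_norm // => tD; apply: pos; rewrite t0.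
- rewrite ltr0_norm // => tD; rewrite -[t ^+ 2]sqrrN.
  apply: le_trans (pos (- t) (fun i => - z i) _) _; first by rewrite oppr_gt0 t0.
  by apply: ler_sum => i _; rewrite mulNr rmorphN /= -opprD sqrrN.
- move=> _; rewrite expr0n /= !mul0r ge_min; apply/orP; left.
  by apply: sumr_ge0 => i _; exact: sqr_ge0.
Qed.

Section RowsAndGrid.
Variables (n : nat) (c0 : R) (d : nat) (alpha : R) (k : nat) (N : R) (X : 'cV[R]_d).
Hypothesis c0_gt0 : 0 < c0.
Hypothesis c0_le : c0 <= 2 ^- 24.
Hypothesis d_gt0 : (0 < d)%N.
Hypothesis d_le : d%:R <= c0 ^+ 2 * n%:R.
Hypothesis alpha_gt0 : 0 < alpha.
Hypothesis k_le : k%:R <= 2 ^- 10 * alpha * d%:R.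
Hypothesis N_gt0 : 0 < N.
Hypothesis N_le : N <= expR (2 ^- 10 * alpha * d%:R).
Hypothesis X_ge : c0 * 2 ^- 10 * Num.sqrt n%:R * N <= norm2 X.
Let r_n := c0 / (16 * Num.sqrt n%:R).
Hypothesis D_gt : 16 < D_alpha alpha (r_n *: X).

Let n_gt0 : 0 < n%:R :> R.
Proof.
have : 0 < d%:R :> R by rewrite ltr0n.
move=> /lt_le_trans/(_ d_le); rewrite pmulr_rgt0 //; exact: exprn_gt0.
Qed.

Let sn_gt0 : 0 < Num.sqrt n%:R :> R. Proof. by rewrite sqrtr_gt0. Qed.
Let sn2 : Num.sqrt n%:R ^+ 2 = n%:R :> R. Proof. by rewrite sqr_sqrtr // ltW. Qed.
Let r_gt0 : 0 < r_n. Proof. by rewrite divr_gt0 // mulr_gt0. Qed.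

Let v (i : 'I_d) : R := r_n * X i 0.
Let V : R := \sum_i v i ^+ 2.

Let V_ge : (c0 ^+ 2 * 2 ^- 14 * N) ^+ 2 <= V.
Proof.
have -> : V = (r_n * norm2 X) ^+ 2.
  by rewrite exprMn norm2_sqr mulr_sumr; apply: eq_bigr => i _; rewrite exprMn.
have h0 : 0 <= c0 ^+ 2 * 2 ^- 14 * N by rewrite !mulr_ge0 ?invr_ge0 ?exprn_ge0 // ltW.
apply: lerXn2r; rewrite ?nnegrE //; first by rewrite mulr_ge0 ?norm2_ge0 ?(ltW r_gt0).
apply: le_trans (ler_wpM2l (ltW r_gt0) X_ge).
by rewrite /r_n le_eqVlt; apply/orP; left; apply/eqP; field; rewrite gt_eqF.
Qed.

Let V_gt0 : 0 < V.
Proof.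
by apply: lt_le_trans V_ge; rewrite exprn_gt0 // !mulr_gt0 ?invr_gt0 ?exprn_gt0.
Qed.

(** [eta] normalizes [eta^2 |v|^2] to [2^18], [L] is the number of multiples of [eta] that fit in
    the bandwidth 16, and [C] cells cover all values of [<v, tau>] for entries bounded by 1. *)
Let eta : R := 2 ^+ 9 / Num.sqrt V.
Let L := (Num.truncn (16 / eta)).+1.
Let C := (Num.truncn (128 * \sum_i `|v i|)).+1.

Let eta_gt0 : 0 < eta. Proof. by rewrite divr_gt0 ?exprn_gt0 ?sqrtr_gt0. Qed.
Let eta_sqr : eta ^+ 2 * V = 2 ^+ 18.
Proof. by rewrite /eta expr_div_n sqr_sqrtr ?(ltW V_gt0) // -mulrA mulVf ?gt_eqF // mulr1 -exprM. Qed.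

Let L_eta : (L%:R - 1) * `|eta| <= 16.
Proof.
rewrite /L -natr1 addrK gtr0_norm // -ler_pdivlMr // truncn_le //.
by rewrite divr_ge0 // ltW.
Qed.

Let L_ge : 12 / L%:R <= 3 / 4 * eta.
Proof.
have : 16 / eta < L%:R by exact: truncnS_gt.
rewrite ltr_pdivrMr // => h.
by rewrite ler_pdivrMr ?ltr0n //; lra.
Qed.

Definition row_weight (I : finType) (B : 'I_(d + d) -> I -> R) x : R :=
  kernel L C eta (ldot v x) * kernel L C eta (rdot v x) * weight B x.

Lemma esp_row_weight (I : finType) (B : 'I_(d + d) -> I -> R) :
  (forall x, qform B x <= \sum_j x j ^+ 2) ->
  (forall x, (forall j, `|x j| <= 1) -> forall i, `|tmulv B x i| <= 1 / 2) ->
  k%:R / 8 <= hs2 B -> hs2 B <= 3 * k%:R ->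
  esp (row_weight B) <= 2 ^+ 47 / c0 ^+ 4 / N ^+ 2 * expR (- (k%:R / 2 ^+ 15)).
Proof.
move=> contr small hs1 hs3.
pose s := 2 ^- 10 * alpha * d%:R.
have ks : k%:R <= s := k_le.
have Ns : N <= expR s := N_le.
have far t : `|t| <= 16 -> forall z : 'I_d -> int,
    Num.min (t ^+ 2 * (\sum_i v i ^+ 2) / 4) (alpha * d%:R) <= \sum_i (t * v i - (z i)%:~R) ^+ 2.
  move=> t16 z; have := D_alpha_far z (ltW alpha_gt0) D_gt t16.
  by under eq_bigr do rewrite mxE; under [leRHS]eq_bigr do rewrite mxE.
have ad0 : 0 <= alpha * d%:R by rewrite mulr_ge0 // ltW.
have := esp_row C contr small (ltn0Sn _ : (0 < L)%N) L_eta eta_sqr ad0 far.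
move=> /le_trans; apply.
set e := expR (- (k%:R / 2 ^+ 15)).
have e0 : 0 < e := expR_gt0 _.
have N20 : 0 < N ^+ 2 by exact: exprn_gt0.
have c40 : 0 < c0 ^+ 4 by exact: exprn_gt0.
have c41 : c0 ^+ 4 <= 1.
  rewrite exprn_ile1 ?(ltW c0_gt0) //; apply: le_trans c0_le _; lra.
(* [hs2 >= k / 8], and [8 * 3520] is below [2^15]. *)
have h1 : expR (- (hs2 B / 3520)) <= e by rewrite ler_expR; lra.
have h2 : (12 / L%:R) ^+ 2 <= 2 ^+ 46 / c0 ^+ 4 / N ^+ 2.
  have l0 : 0 <= 12 / L%:R :> R by rewrite divr_ge0.
  have : (12 / L%:R) ^+ 2 <= (3 / 4 * eta) ^+ 2.
    by rewrite lerXn2r ?nnegrE // mulr_ge0 // ?(ltW eta_gt0) // divr_ge0.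
  move=> /le_trans; apply.
  have -> : (3 / 4 * eta) ^+ 2 = 9 * 2 ^+ 14 / V.
    have -> : 9 * 2 ^+ 14 = 9 / 16 * (eta ^+ 2 * V) by rewrite eta_sqr; field.
    by field; rewrite gt_eqF.
  rewrite ler_pdivrMr //.
  apply: (@le_trans _ _ (2 ^+ 46 / c0 ^+ 4 / N ^+ 2 * (c0 ^+ 2 * 2 ^- 14 * N) ^+ 2)).
    have -> : 2 ^+ 46 / c0 ^+ 4 / N ^+ 2 * (c0 ^+ 2 * 2 ^- 14 * N) ^+ 2 = 2 ^+ 18.
      by field; rewrite !gt_eqF.
    lra.
  by rewrite ler_wpM2l // !divr_ge0 ?exprn_ge0 // ltW.
(* With [alpha d / 32 = 32 s], the cap pays for [exp (9 k / 8)], for [N^2 <= exp (2 s)] and for the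
   factor [e], because [k <= s]. *)
have h3 : 16 * expR (hs2 B * 3 / 8 - alpha * d%:R / 32) <= 2 ^+ 46 / c0 ^+ 4 / N ^+ 2 * e.
  have e2 : expR (hs2 B * 3 / 8 - alpha * d%:R / 32) <= (N ^+ 2)^-1 * e.
    apply: (@le_trans _ _ (expR (- (2%:R * s)) * e)).
      rewrite -expRD ler_expR.
      have -> : alpha * d%:R / 32 = 32 * s by rewrite /s; field.
      have : 0 <= k%:R :> R by exact: ler0n.
      lra.
    rewrite ler_pM2r // expRN lef_pV2 ?posrE ?expR_gt0 // expRM_natl.
    by apply: lerXn2r; rewrite ?nnegrE ?expR_ge0 // ltW.
  apply: (@le_trans _ _ (16 * ((N ^+ 2)^-1 * e))); first by rewrite ler_pM2l.
  rewrite -mulrA; apply: ler_wpM2r; first by rewrite mulr_ge0 ?invr_ge0 ?(ltW N20) ?(ltW e0).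
  by rewrite ler_pdivlMr //; lra.
have -> : 2 ^+ 47 / c0 ^+ 4 / N ^+ 2 * e =
   e * (2 ^+ 46 / c0 ^+ 4 / N ^+ 2) + 2 ^+ 46 / c0 ^+ 4 / N ^+ 2 * e.
  by field; rewrite !gt_eqF.
apply: lerD => //; apply: ler_pM => //; first exact: expR_ge0.
exact: sqr_ge0.
Qed.


Let c0_small : c0 <= 1 / 8. Proof. by apply: le_trans c0_le _; lra. Qed.

Let c0_sqr : c0 ^+ 2 <= 1 / 64.
Proof. by have := c0_small; have := c0_gt0; rewrite expr2; nra. Qed.

(** Row [i] costs [b i + 1] factors 1/2. With [w = |y i| / (r_n sqrt n)] one has
    [b i <= 8 c0 w <= w <= (1 + w^2) / 2], and the [w^2] sum to at most [n], so the total is at most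
    [3n/2 + n/2]. *)
Lemma kernel_prod_lower (y : 'I_(n - d) -> R) :
  (forall i, `|y i| <= \sum_j `|v j|) -> \sum_i y i ^+ 2 <= (r_n * n%:R) ^+ 2 ->
  (1 / 2) ^+ (2 * n) <= \prod_i kernel L C eta (y i).
Proof.
move=> yC y2.
pose b i := Num.truncn (128 * `|y i|).
have bC i : (b i < C)%N.
  by rewrite ltnS; apply: le_truncn; rewrite ler_pM2l.
apply: (@le_trans _ _ (\prod_(i < n - d) (1 / 2) ^+ (b i).+1)); last first.
  apply: ler_prod => i _; rewrite half_exp_ge0 /=.
  by apply: kernel_lower => //; exact: bC.
rewrite -expr_sum; apply: ler_wiXn2l; [by rewrite divr_ge0|by lra|].
rewrite -(ler_nat R) natr_sum.
have rn2 : 0 < r_n ^+ 2 * n%:R by rewrite mulr_gt0 ?exprn_gt0.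
apply: (@le_trans _ _ (\sum_(i < n - d) (3 / 2 + y i ^+ 2 / (2 * (r_n ^+ 2 * n%:R))))).
  apply: ler_sum => i _; rewrite -natr1.
  have hb : (b i)%:R <= 128 * `|y i| by rewrite truncn_le mulr_ge0.
  pose w := `|y i| / (r_n * Num.sqrt n%:R).
  have w0 : 0 <= w by rewrite divr_ge0 // mulr_ge0 // ltW.
  have -> : y i ^+ 2 / (2 * (r_n ^+ 2 * n%:R)) = w ^+ 2 / 2.
    rewrite /w -[in LHS]sn2 [in RHS]expr_div_n real_normK ?num_real //.
    by field; rewrite !gt_eqF.
  have e : 128 * `|y i| = 8 * c0 * w.
    by rewrite /w /r_n; field; rewrite !gt_eqF.
  have : 8 * c0 * w <= w by rewrite ler_piMl //; have := c0_small; lra.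
  have := sqr_ge0 (w - 1); rewrite e in hb; lra.
rewrite big_split /= sumr_const card_ord -mulr_suml -[_ *+ _]mulr_natr natrM.
have h1 : (\sum_i y i ^+ 2) / (2 * (r_n ^+ 2 * n%:R)) <= n%:R / 2.
  have dn : 0 < 2 * (r_n ^+ 2 * n%:R) by rewrite mulr_gt0.
  rewrite (ler_pdivrMr _ _ dn); apply: le_trans y2 _.
  by rewrite le_eqVlt; apply/orP; left; apply/eqP; field.
have h2 : (n - d)%:R <= n%:R :> R by rewrite ler_nat leq_subr.
lra.
Qed.

(** Twice the sum of [c0^2 n k / 256], from the small singular values, and [2 c0^2 n k / 256], from
    rounding. *)
Let hs_bound := 3 / 128 * c0 ^+ 2 * n%:R * k%:R.

Lemma row_weight_lower (I : finType) (B : 'I_(d + d) -> I -> R) (H : 'M[R]_(n - d, d + d)) :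
  (forall i j, `|H i j| <= 1) ->
  norm2 (lsubmx H *m X) <= n%:R -> norm2 (rsubmx H *m X) <= n%:R ->
  \sum_i qform B (H i) <= hs_bound ->
  1 <= 2 ^+ (4 * n) * expR (16 * hs_bound) * \prod_i row_weight B (H i).
Proof.
move=> H1 Hl Hr Hq.
have dot_le (G : 'M[R]_(n - d, d)) : (forall i j, `|G i j| <= 1) -> norm2 (G *m X) <= n%:R ->
    (forall i, `|\sum_j v j * G i j| <= \sum_j `|v j|) /\
    \sum_i (\sum_j v j * G i j) ^+ 2 <= (r_n * n%:R) ^+ 2.
  move=> G1 Gn; split=> [i|].
    apply: le_trans (ler_norm_sum _ _ _) _; apply: ler_sum => j _.
    by rewrite normrM ler_piMr.
  have -> : \sum_i (\sum_j v j * G i j) ^+ 2 = (r_n * norm2 (G *m X)) ^+ 2.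
    rewrite exprMn norm2_sqr mulr_sumr; apply: eq_bigr => i _.
    rewrite -exprMn mxE mulr_sumr; congr (_ ^+ 2); apply: eq_bigr => j _.
    by rewrite /v -mulrA [X in _ * X]mulrC.
  apply: lerXn2r; rewrite ?nnegrE.
  - exact: mulr_ge0 (ltW r_gt0) (norm2_ge0 _).
  - exact: mulr_ge0 (ltW r_gt0) (ler0n _ _).
  - exact: ler_wpM2l (ltW r_gt0) _ _ Gn.
have [l1 l2] : (forall i, `|ldot v (H i)| <= \sum_j `|v j|) /\
    \sum_i ldot v (H i) ^+ 2 <= (r_n * n%:R) ^+ 2.
  have G1 i j : `|lsubmx H i j| <= 1 by rewrite mxE.
  have [a1 a2] := dot_le _ G1 Hl; split=> [i|].
    by have := a1 i; under eq_bigr do rewrite mxE.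
  by move: a2; under eq_bigr do under eq_bigr do rewrite mxE.
have [r1 r2] : (forall i, `|rdot v (H i)| <= \sum_j `|v j|) /\
    \sum_i rdot v (H i) ^+ 2 <= (r_n * n%:R) ^+ 2.
  have G1 i j : `|rsubmx H i j| <= 1 by rewrite mxE.
  have [a1 a2] := dot_le _ G1 Hr; split=> [i|].
    by have := a1 i; under eq_bigr do rewrite mxE.
  by move: a2; under eq_bigr do under eq_bigr do rewrite mxE.
have kl := kernel_prod_lower l1 l2; have kr := kernel_prod_lower r1 r2.
have wl : expR (- (16 * hs_bound)) <= \prod_i weight B (H i).
  apply: (@le_trans _ _ (expR (\sum_i - (16 * qform B (H i))))).
    by rewrite ler_expR sumrN -mulr_sumr lerN2 ler_pM2l.
  rewrite expR_sum; apply: ler_prod => i _; rewrite expR_ge0 /=.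
  exact: weight_lower.
rewrite /row_weight !big_split /=.
apply: (@le_trans _ _ (2 ^+ (4 * n) * expR (16 * hs_bound) *
    ((1 / 2) ^+ (2 * n) * (1 / 2) ^+ (2 * n) * expR (- (16 * hs_bound))))).
  rewrite expRN -exprD -mulnDl mulrACA -exprMn [2 * _]mulrC mulfVK ?pnatr_eq0 //.
  by rewrite expr1n mul1r mulfV // gt_eqF // expR_gt0.
apply: ler_wpM2l; first by rewrite mulr_ge0 ?expR_ge0 ?exprn_ge0.
by apply: ler_pM => //; rewrite ?mulr_ge0 ?half_exp_ge0 ?expR_ge0 //; apply: ler_pM; rewrite ?half_exp_ge0.
Qed.

Hypothesis alpha_lt1 : alpha < 1.

(** [eps] makes the rounding error of a column have norm at most [del]; then [2 k del^2 <= k / 64].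
    The bound [bnd] on the grid coordinates is deliberately crude. *)
Let del := c0 / 16.
Let eps := del / Num.sqrt (d + d)%:R.
Let bnd := (Num.truncn ((k%:R + 1) / eps + 1)).+1.

Let dd_gt0 : 0 < (d + d)%:R :> R. Proof. by rewrite ltr0n addn_gt0 d_gt0. Qed.
Let del_gt0 : 0 < del. Proof. by rewrite divr_gt0. Qed.
Let eps_gt0 : 0 < eps. Proof. by rewrite divr_gt0 ?sqrtr_gt0. Qed.
Let eps_sqr : eps ^+ 2 * (d + d)%:R = del ^+ 2.
Proof. by rewrite /eps expr_div_n sqr_sqrtr ?(ltW dd_gt0) // mulfVK ?gt_eqF. Qed.

Definition grid_mx (z : 'M['I_(bnd + bnd).+1]_(d + d, k + k)) : 'M[R]_(d + d, k + k) :=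
  eps *: \matrix_(i, j) ((z i j)%:R - bnd%:R).

(** The property a grid point retains of the frame it approximates. It does not mention [H], so the
    union bound can run over all points that have it. *)
Let near_frame (V : 'M[R]_(d + d, k + k)) := exists U : 'M[R]_(d + d, k + k),
  [/\ bessel U, hs U = k%:R & hs (V - U) <= k%:R / 64].

Let hsD_le p q (A B : 'M[R]_(p, q)) : hs (A + B) <= 2 * (hs A + hs B).
Proof.
have := hs_ge0 (A + (-1) *: B); rewrite !hsD hsZ -scalemxAr mxtraceZ; lra.
Qed.

Let near_frame_hs W : near_frame W -> hs W <= 3 * k%:R.
Proof.
move=> [U [_ hU hE]]; rewrite -(subrK U W); apply: le_trans (hsD_le _ _) _.
by have : 0 <= k%:R :> R := ler0n _ _; lra.
Qed.

Lemma grid_cover (H : 'M[R]_(n - d, d + d)) : (forall i j, `|H i j| <= 1) ->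
  sing_val H (2 * d - k + 1) <= c0 * 2 ^- 4 * Num.sqrt n%:R ->
  exists2 z, near_frame (grid_mx z) & hs (H *m grid_mx z) <= hs_bound.
Proof.
move=> H1 Hs.
have kd : (k <= d + d)%N.
  rewrite -(ler_nat R); apply: le_trans k_le _; rewrite natrD.
  by have d0 : 0 <= d%:R :> R := ler0n _ _; have := alpha_lt1; have := alpha_gt0; nra.
have s0 : 0 <= c0 * 2 ^- 4 * Num.sqrt n%:R.
  by rewrite !mulr_ge0 ?invr_ge0 ?exprn_ge0 // ltW.
have [|U [bU hU HU]] := small_sing_frame kd s0 (H := H).
  by move=> _; have -> : (d + d - k + 1 = 2 * d - k + 1)%N by rewrite addnn mul2n.
have [Z [E1 HE]] := round_mx eps_gt0 H U.
set E := eps *: map_mx intr Z - U in E1 HE.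
have VE : eps *: map_mx intr Z = U + E by rewrite /E addrC subrK.
have hsE2 : hs E <= k%:R / 64.
  apply: (@le_trans _ _ (\sum_(i < d + d) \sum_(j < k + k) eps ^+ 2)).
    apply: ler_sum => i _; apply: ler_sum => j _.
    by rewrite -[E i j ^+ 2]real_normK ?num_real // lerXn2r ?nnegrE // ltW.
  rewrite !sumr_const !card_ord -mulrnA -[leLHS]mulr_natr natrM mulrCA eps_sqr natrD /del.
  have := c0_sqr; rewrite expr_div_n.
  by have k0 : 0 <= k%:R :> R := ler0n _ _; nra.
have hsH : hs H <= n%:R * (d + d)%:R.
  apply: (@le_trans _ _ (\sum_(i < n - d) \sum_(j < d + d) (1 : R))).
    apply: ler_sum => i _; apply: ler_sum => j _.
    by rewrite -[H i j ^+ 2]real_normK ?num_real // expr_le1.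
  rewrite !sumr_const !card_ord -mulrnA -[leLHS]mulr_natr natrM mul1r [leRHS]mulrC.
  by rewrite ler_wpM2l ?ler0n // ler_nat leq_subr.
have Zb i j : `|Z i j| <= bnd%:Z.
  have Uk : `|U i j| <= k%:R + 1.
    have Uij : U i j ^+ 2 <= k%:R.
      rewrite -hU /hs (bigD1 i) //= (bigD1 j) //= -addrA lerDl addr_ge0 //.
        by apply: sumr_ge0 => l _; exact: sqr_ge0.
      by apply: sumr_ge0 => l _; apply: sumr_ge0 => m _; exact: sqr_ge0.
    rewrite -[U i j ^+ 2]real_normK ?num_real // in Uij.
    have k0 : 0 <= k%:R :> R := ler0n _ _; have := normr_ge0 (U i j); nra.
  have : `|eps * (Z i j)%:~R| <= k%:R + 1 + eps.
    have -> : eps * (Z i j)%:~R = U i j + E i j.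
      by have /matrixP/(_ i j) := VE; rewrite mxE [map_mx _ _ _ _]mxE [RHS]mxE.
    by apply: le_trans (ler_normD _ _) _; apply: lerD.
  rewrite normrM gtr0_norm // => h.
  rewrite -(ler_int R) intr_norm; apply: ltW.
  apply: le_lt_trans (truncnS_gt ((k%:R + 1) / eps + 1)).
  rewrite -(ler_pM2l eps_gt0); apply: le_trans h _.
  by rewrite mulrDr mulr1 mulrC divfK ?gt_eqF.
pose z : 'M['I_(bnd + bnd).+1]_(d + d, k + k) := \matrix_(i, j) inord (absz (Z i j + bnd%:Z)).
have gE : grid_mx z = U + E.
  rewrite -VE /grid_mx; congr (_ *: _); apply/matrixP => i j; rewrite !mxE.
  have := Zb i j; rewrite ler_norml => /andP[z1 z2].
  have w0 : 0 <= Z i j + bnd%:Z by rewrite -lerBlDr sub0r.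
  rewrite inordK.
    by rewrite natr_absz ger0_norm // intrD addrK.
  by rewrite ltnS -lez_nat gez0_abs // PoszD lerD2r.
exists z; first by exists U; rewrite gE; split=> //; rewrite addrC addKr.
rewrite gE mulmxDr; apply: le_trans (hsD_le _ _) _.
have HE' : hs (H *m E) <= (k + k)%:R * n%:R * del ^+ 2.
  apply: le_trans HE _; rewrite -eps_sqr.
  have -> : (k + k)%:R * n%:R * (eps ^+ 2 * (d + d)%:R) = (k + k)%:R * eps ^+ 2 * (n%:R * (d + d)%:R) by ring.
  by rewrite ler_wpM2l // mulr_ge0 ?ler0n ?sqr_ge0.
have HU' : hs (H *m U) <= c0 ^+ 2 / 256 * n%:R * k%:R.
  apply: le_trans HU _; rewrite !exprMn sn2 le_eqVlt; apply/orP; left; apply/eqP.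
  by field.
rewrite /hs_bound; rewrite natrD /del in HE'; lra.
Qed.

Lemma grid_point_prob z : near_frame (grid_mx z) ->
  probH (fun H : 'M[R]_(n - d, d + d) => [&& hs (H *m grid_mx z) <= hs_bound,
     norm2 (lsubmx H *m X) <= n%:R & norm2 (rsubmx H *m X) <= n%:R])
  <= 2 ^+ (4 * n) * expR (16 * hs_bound) *
     (2 ^+ 47 / c0 ^+ 4 / N ^+ 2 * expR (- (k%:R / 2 ^+ 15))) ^+ (n - d).
Proof.
move=> nz; have hV := near_frame_hs nz; case: nz => U [bU hU hE].
have [I [B [contr small qV hs1 hs3]]] := frame_columns bU hU hE.
have f0 x : 0 <= row_weight B x.
  by rewrite !mulr_ge0 ?weight_ge0 ?kernel_ge0.
have cst0 : 0 <= 2 ^+ (4 * n) * expR (16 * hs_bound).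
  by rewrite mulr_ge0 ?expR_ge0 ?exprn_ge0.
apply: le_trans (probH_tensor cst0 f0 _) _.
  move=> H H1 /and3P[Hz Hl Hr]; apply: row_weight_lower => //.
  (* Summed over the rows of [H], the forms [|V^T tau|^2] give [hs (H V)]. *)
  apply: le_trans Hz; rewrite -hs_tr trmx_mul hs_col.
  apply: ler_sum => i _; apply: le_trans (qV _) _.
  rewrite colE -mulmxA -colE le_eqVlt; apply/orP; left; apply/eqP.
  by congr (hs (_ *m _)); apply/colP => j; rewrite !mxE.
apply: ler_wpM2l => //; apply: lerXn2r; rewrite ?nnegrE.
- exact: esp_ge0.
- by rewrite !mulr_ge0 ?invr_ge0 ?expR_ge0 ?exprn_ge0 // ltW.
- by apply: esp_row_weight => //; apply: le_trans hs3 _.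
Qed.

(** The near-frame bound is on squares; [|y| <= (del y^2 + 1 / del) / 2] converts it to the l1 bound
    [(6 d k + 4 d k) / (2 del)], where [4 d k] is the number of entries. *)
Lemma grid_card : #|[pred z | `[< near_frame (grid_mx z) >]]|%:R <=
  expR (5 * d%:R * k%:R) * (48 / c0) ^+ (4 * d * k).
Proof.
have -> : 48 / c0 = 3 / del by rewrite /del; field; rewrite gt_eqF.
have -> : (4 * d * k = (d + d) * (k + k))%N by rewrite !addnn -!mul2n mulnACA mulnA.
have -> : 5 * d%:R * k%:R = del * (5 * d%:R * k%:R / del).
  by field; rewrite gt_eqF.
apply: count_l1_ball => //; first by rewrite /del; have := c0_small; lra.
move=> z /asboolP/near_frame_hs hz.
pose y i j : R := (z i j)%:R - bnd%:R.
have hy : eps ^+ 2 * \sum_i \sum_j y i j ^+ 2 <= 3 * k%:R.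
  apply: le_trans hz; rewrite /grid_mx hsZ le_eqVlt; apply/orP; left; apply/eqP.
  by congr (_ * _); apply: eq_bigr => i _; apply: eq_bigr => j _; rewrite mxE.
have hy2 : del ^+ 2 * \sum_i \sum_j y i j ^+ 2 <= 6 * d%:R * k%:R.
  rewrite -eps_sqr mulrAC; have := ler_wpM2r (ler0n R (d + d)) hy; rewrite natrD; lra.
apply: (@le_trans _ _ (\sum_(i < d + d) \sum_(j < k + k) (del * y i j ^+ 2 + del^-1) / 2)).
  apply: ler_sum => i _; apply: ler_sum => j _; rewrite -/(y i j).
  rewrite ler_pdivlMr // -[y i j ^+ 2]real_normK ?num_real //.
  rewrite -(ler_pM2r del_gt0) mulrDl mulVf ?gt_eqF //.
  by have := sqr_ge0 (del * `|y i j| - 1); lra.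
under eq_bigr do rewrite -mulr_suml big_split /= -mulr_sumr sumr_const card_ord.
rewrite -mulr_suml big_split /= -mulr_sumr sumr_const card_ord -mulrnA.
rewrite -[del^-1 *+ _]mulr_natr natrM !natrD.
rewrite ler_pdivlMr //; move: hy2; set S := \sum_i _ => hy2.
have -> : (del * S + del^-1 * ((k%:R + k%:R) * (d%:R + d%:R))) / 2 * del =
    (del ^+ 2 * S + 4 * d%:R * k%:R) / 2.
  by field; rewrite gt_eqF.
lra.
Qed.

Lemma small_sing_probability :
  probH (fun H : 'M[R]_(n - d, d + d) =>
     [&& sing_val H (2 * d - k + 1) <= c0 * 2 ^- 4 * Num.sqrt n%:R,
         norm2 (lsubmx H *m X) <= n%:R &
         norm2 (rsubmx H *m X) <= n%:R])
  <= expR (- (c0 * n%:R * k%:R / 4)) * (2 ^+ 39 / c0 ^+ 3 / N) ^+ (2 * n - 2 * d).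
Proof.
pose P z := `[< near_frame (grid_mx z) >].
pose F z (H : 'M[R]_(n - d, d + d)) := [&& hs (H *m grid_mx z) <= hs_bound,
     norm2 (lsubmx H *m X) <= n%:R & norm2 (rsubmx H *m X) <= n%:R].
apply: le_trans (probH_union (P := P) (F := F) _) _.
  move=> H H1 /and3P[Hs Hl Hr]; have [z nz Hz] := grid_cover H1 Hs.
  by exists z; [exact/asboolP | rewrite /F Hz Hl Hr].
set Q := 2 ^+ 47 / c0 ^+ 4 / N ^+ 2.
apply: (@le_trans _ _ (\sum_(z | P z) (2 ^+ (4 * n) * expR (16 * hs_bound) *
     (Q * expR (- (k%:R / 2 ^+ 15))) ^+ (n - d)))).
  by apply: ler_sum => z /asboolP/grid_point_prob.
rewrite sumr_const -[leLHS]mulr_natl.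
have Q0 : 0 < Q by rewrite !divr_gt0 ?exprn_gt0.
have cst0 : 0 <= 2 ^+ (4 * n) * expR (16 * hs_bound) * (Q * expR (- (k%:R / 2 ^+ 15))) ^+ (n - d).
  apply: mulr_ge0; first by rewrite mulr_ge0 ?expR_ge0 ?exprn_ge0.
  by rewrite exprn_ge0 // mulr_ge0 ?expR_ge0 ?(ltW Q0).
apply: le_trans (ler_wpM2r cst0 grid_card) _.
have n0 := ltW n_gt0.
have c1 : c0 <= 2 ^- 24 := c0_le.
have dn2 : d%:R <= n%:R / 2 :> R.
  apply: le_trans d_le _; rewrite mulrC; have := c0_sqr; nra.
have dn : (d <= n)%N by rewrite -(ler_nat R); lra.
have nd : (n - d)%:R = n%:R - d%:R :> R by rewrite natrB.
(* With [x = 1 / (256 c0)], [48 / c0 <= x^2 <= exp (2 x)] because [c0 <= 2^-24]. The resulting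
   exponent [d k / (32 c0)] is at most [c0 n k / 32]. *)
have base : (48 / c0) ^+ (4 * d * k) <= expR (d%:R * k%:R / (32 * c0)).
  have h : 48 / c0 <= expR (1 / (128 * c0)).
    have -> : 1 / (128 * c0) = 1 / (256 * c0) + 1 / (256 * c0) by field; rewrite gt_eqF.
    have x0 : 0 < 1 / (256 * c0) by rewrite divr_gt0 // mulr_gt0.
    apply: (@le_trans _ _ (1 / (256 * c0) * (1 / (256 * c0)))).
      have -> : 1 / (256 * c0) * (1 / (256 * c0)) = 1 / (2 ^+ 16 * c0) / c0.
        by field; rewrite gt_eqF.
      rewrite ler_pM2r ?invr_gt0 // ler_pdivlMr ?mulr_gt0 ?exprn_gt0 //; lra.
    have := expR_ge1Dx (1 / (256 * c0)); rewrite expRD => hx.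
    by apply: ler_pM; rewrite ?(ltW x0) //; apply: le_trans hx; rewrite lerDr.
  apply: (@le_trans _ _ (expR (1 / (128 * c0)) ^+ (4 * d * k))).
    by apply: lerXn2r; rewrite ?nnegrE ?expR_ge0 // divr_ge0 // ltW.
  rewrite -expRM_natl !natrM ler_expR le_eqVlt; apply/orP; left; apply/eqP.
  by field; rewrite gt_eqF.
have two : 2 ^+ (4 * n) <= (2 ^+ 8) ^+ (n - d) :> R.
  rewrite -exprM; apply: ler_weXn2l; first lra.
  by rewrite -(ler_nat R) !natrM nd; lra.
have QQ : (2 ^+ 8 * Q) ^+ (n - d) <= (2 ^+ 39 / c0 ^+ 3 / N) ^+ (2 * n - 2 * d).
  rewrite -mulnBr exprM; apply: lerXn2r; rewrite ?nnegrE.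
  - by rewrite mulr_ge0 ?exprn_ge0 // ltW.
  - exact: sqr_ge0.
  - have -> : 2 ^+ 8 * Q = 2 ^+ 55 * c0 ^+ 2 / (c0 ^+ 6 * N ^+ 2).
      by rewrite /Q; field; rewrite !gt_eqF.
    have -> : (2 ^+ 39 / c0 ^+ 3 / N) ^+ 2 = 2 ^+ 78 / (c0 ^+ 6 * N ^+ 2).
      by field; rewrite !gt_eqF.
    rewrite ler_pM2r ?invr_gt0 ?mulr_gt0 ?exprn_gt0 //.
    by have := c0_sqr; lra.
(* The decay is at least [n k / 2^16], as [d <= n / 2], while every cost and the target exponent are
   [O(c0 n k)]. *)
have expo : 5 * d%:R * k%:R + d%:R * k%:R / (32 * c0) + 16 * hs_bound
      - k%:R / 2 ^+ 15 * (n - d)%:R <= - (c0 * n%:R * k%:R / 4).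
  have c2 : c0 ^+ 2 * n%:R <= c0 * n%:R * 2 ^- 24.
    by rewrite expr2 -mulrA -[leRHS]mulrA ler_pM2l // mulrC ler_wpM2l.
  have c3 : c0 * n%:R <= 2 ^- 24 * n%:R by rewrite ler_wpM2r.
  have Dc : d%:R / (32 * c0) <= c0 * n%:R / 32.
    rewrite ler_pdivrMr ?mulr_gt0 //; apply: le_trans d_le _.
    by rewrite le_eqVlt; apply/orP; left; apply/eqP; field.
  have : 5 * d%:R + d%:R / (32 * c0) + 16 * (3 / 128 * c0 ^+ 2 * n%:R)
      - (n%:R - d%:R) / 2 ^+ 15 <= - (c0 * n%:R / 4).
    have := d_le; have c0n : 0 <= c0 * n%:R by rewrite mulr_ge0 // ltW.
    lra.
  move=> /(ler_wpM2r (ler0n R k)); rewrite nd /hs_bound; lra.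
apply: (@le_trans _ _ (expR (5 * d%:R * k%:R) * expR (d%:R * k%:R / (32 * c0)) *
   ((2 ^+ 8) ^+ (n - d) * expR (16 * hs_bound) * (Q * expR (- (k%:R / 2 ^+ 15))) ^+ (n - d)))).
  apply: ler_pM => //.
  - by rewrite mulr_ge0 ?expR_ge0 // exprn_ge0 // divr_ge0 // ltW.
  - by rewrite ler_wpM2l ?expR_ge0.
  - rewrite ler_wpM2r ?ler_wpM2r ?expR_ge0 //.
    by rewrite exprn_ge0 // mulr_ge0 ?expR_ge0 ?(ltW Q0).
apply: (@le_trans _ _ (expR (- (c0 * n%:R * k%:R / 4)) * (2 ^+ 8 * Q) ^+ (n - d))); last first.
  by rewrite ler_wpM2l ?expR_ge0.
rewrite [(Q * _) ^+ _]exprMn -[expR _ ^+ _]expRM_natl [(2 ^+ 8 * Q) ^+ _]exprMn.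
rewrite -expRD.
set a := (2 ^+ 8) ^+ _; set q := Q ^+ _.
have aq0 : 0 <= a * q by rewrite mulr_ge0 ?exprn_ge0 // ltW.
set e1 := expR (_ + _); set e2 := expR (16 * _); set e3 := expR (_ * _).
have -> : e1 * (a * e2 * (q * e3)) = e1 * e2 * e3 * (a * q) by ring.
apply: ler_wpM2r => //; rewrite /e1 /e2 /e3 -!expRD ler_expR.
by move: expo; lra.
Qed.

End RowsAndGrid.
End Main.

Theorem theorem5p1 (R : realType) (n : nat) (c0 : R) (d : nat) (alpha : R)
  (k : nat) (N : R) (X : 'cV[R]_d) :
  0 < c0 -> c0 <= 2 ^- 24 ->
  (0 < d)%N -> d%:R <= c0 ^+ 2 * n%:R ->
  0 < alpha -> alpha < 1 ->
  k%:R <= 2 ^- 10 * alpha * d%:R ->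
  0 < N -> N <= expR (2 ^- 10 * alpha * d%:R) ->
  c0 * 2 ^- 10 * Num.sqrt n%:R * N <= norm2 X ->
  let r_n := c0 / (16 * Num.sqrt n%:R) in
  let RR := 2 ^+ 39 / c0 ^+ 3 in
  16 < D_alpha alpha (r_n *: X) ->
  probH (fun H : 'M[R]_(n - d, d + d) =>
     [&& sing_val H (2 * d - k + 1) <= c0 * 2 ^- 4 * Num.sqrt n%:R,
         norm2 (lsubmx H *m X) <= n%:R &
         norm2 (rsubmx H *m X) <= n%:R])
  <= expR (- (c0 * n%:R * k%:R / 4)) * (RR / N) ^+ (2 * n - 2 * d).
Proof.
move=> c0_gt0 c0_le d_gt0 d_le a_gt0 a_lt1 k_le N_gt0 N_le X_ge r_n RR D_gt.
exact: (small_sing_probability c0_gt0 c0_le d_gt0 d_le a_gt0 k_le N_gt0 N_le X_ge D_gt a_lt1).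
Qed.
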